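(* Suppose that Algorithm IP-PMM terminates when a limit point is reached. Assume: (1) there exists an optimal solution $(x^*,y^*,z^* )$ of the primal-dual pair (P)-(D) with $\|x^*\|_\infty\le C^*$, $\|y^*\|_\infty\le C^*$, $\|z^*\|_\infty\le C^*$ for some constant $C^*\ge 0$ independent of $n$ and $m$; (2) $\operatorname{rank}(A)=m$, and there exist constants $C_A^1>0$, $C_A^2>0$, $C_Q>0$, $C_r>0$, independent of $n$ and $m$, such that $\eta_{\min}(A)\ge C_A^1$, $\eta_{\max}(A)\le C_A^2$, $\nu_{\max}(Q)\le C_Q$ and $\|(c,b)\|_\infty\le C_r$. Then every limit point of the sequence $\{(x_k,y_k,z_k)\}$ generated by Algorithm IP-PMM determines a primal-dual solution of the pair (P)-(D), i.e. it satisfies $c+Qx-A^Ty-z=0$, $Ax-b=0$, $XZe_n=0$, $(x,z)\ge(0,0)$.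
   Context: Problem. $A\in\mathbb{R}^{m\times n}$ with $m\le n$, $Q\in\mathbb{R}^{n\times n}$ is symmetric positive semi-definite, $b\in\mathbb{R}^m$, $c\in\mathbb{R}^n$. The primal-dual pair is (P) $\min_x\ c^Tx+\frac12x^TQx$ s.t. $Ax=b$, $x\ge0$; (D) $\max_{x,y,z}\ b^Ty-\frac12x^TQx$ s.t. $-Qx+A^Ty+z=c$, $z\ge0$. Notation. Superscripts denote components; $e_n$ is the all-ones vector; $X,Z$ (resp. $X_k,Z_k$) are the diagonal matrices with diagonals $x,z$ (resp. $x_k,z_k$). $\eta_{\min},\eta_{\max}$ are minimum/maximum singular values and $\nu_{\max}$ the maximum eigenvalue. $O(1)$ denotes a quantity bounded by a constant independent of $n$ and $m$. Semi-norm. For $b'\in\mathbb{R}^m,\ c'\in\mathbb{R}^n$: $\|(b',c')\|_{\mathcal A}:=\min_{x,y,z}\{\|(x,z)\|_2: Ax=b',\ -Qx+A^Ty+z=c'\}$. Starting point. $(x_0,z_0)=\rho(e_n,e_n)$ for some constant $\rho>0$; $y_0$ is any vector with $\|y_0\|_\infty=O(1)$; $\mu_0=x_0^Tz_0/n$; $\bar b:=Ax_0-b$, $\bar c:=-Qx_0+A^Ty_0+z_0-c$; $\zeta_0=x_0$, $\lambda_0=y_0$. Neighbourhood. Fix constants $C_N>0$, $\gamma_{\mathcal A},\gamma_\mu\in(0,1)$. For $\mu>0$, $\zeta\in\mathbb{R}^n$, $\lambda\in\mathbb{R}^m$, $\mathcal N_\mu(\zeta,\lambda)$ is the set of $(x,y,z)$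 with $(x,z)>(0,0)$, $x^iz^i\ge\gamma_\mu\mu$ for all $i\in\{1,\dots,n\}$, and such that for some $\tilde b\in\mathbb{R}^m,\tilde c\in\mathbb{R}^n$ with $\|(\tilde b,\tilde c)\|_2\le C_N$, $\|(\tilde b,\tilde c)\|_{\mathcal A}\le\gamma_{\mathcal A}\rho$: $Ax+\mu(y-\lambda)=b+\frac{\mu}{\mu_0}(\bar b+\tilde b)$, $\ -Qx+A^Ty+z-\mu(x-\zeta)=c+\frac{\mu}{\mu_0}(\bar c+\tilde c)$. Algorithm IP-PMM. Parameters $0<\sigma_{\min}\le\sigma_{\max}\le0.5$, the constants $C_N>0$ and $\gamma_{\mathcal A},\gamma_\mu\in(0,1)$ used to define the neighbourhood $\mathcal N_\mu(\zeta,\lambda)$, and a tolerance $\mathrm{tol}$. For $k=0,1,2,\dots$: if $\|Ax_k-b\|_2<\mathrm{tol}$, $\|c+Qx_k-A^Ty_k-z_k\|_2<\mathrm{tol}$ and $\mu_k<\mathrm{tol}$, return $(x_k,y_k,z_k)$. (In the present statement this test is replaced by termination only when a limit point is reached, so the iteration is otherwise continued indefinitely.) Otherwise: (a) choose $\sigma_k\in[\sigma_{\min},\sigma_{\max}]$ and compute the Newton direction $(\Delta x_k,\Delta y_k,\Delta z_k)$ from $-(Q+\mu_kI_n)\Delta x_k+A^T\Delta y_k+\Delta z_k=(c+\frac{\sigma_k\mu_k}{\mu_0}\bar c)+Qx_k-A^Ty_k-z_k+\sigma_k\mu_k(x_k-\zeta_k)$, $A\Delta x_k+\mu_k\Delta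 y_k=(b+\frac{\sigma_k\mu_k}{\mu_0}\bar b)-Ax_k-\sigma_k\mu_k(y_k-\lambda_k)$, $Z_k\Delta x_k+X_k\Delta z_k=-X_kZ_ke_n+\sigma_k\mu_ke_n$; (b) let $\alpha_k$ be the largest $\alpha\in(0,1]$ such that $\mu_k(\alpha)\le(1-0.01\alpha)\mu_k$ and $(x_k+\alpha\Delta x_k,y_k+\alpha\Delta y_k,z_k+\alpha\Delta z_k)\in\mathcal N_{\mu_k(\alpha)}(\zeta_k,\lambda_k)$, where $\mu_k(\alpha)=\frac{(x_k+\alpha\Delta x_k)^T(z_k+\alpha\Delta z_k)}{n}$; (c) set $(x_{k+1},y_{k+1},z_{k+1})=(x_k,y_k,z_k)+\alpha_k(\Delta x_k,\Delta y_k,\Delta z_k)$, $\mu_{k+1}=x_{k+1}^Tz_{k+1}/n$; (d) let $r_p=Ax_{k+1}-(b+\frac{\mu_{k+1}}{\mu_0}\bar b)$, $r_d=-Qx_{k+1}+A^Ty_{k+1}+z_{k+1}-(c+\frac{\mu_{k+1}}{\mu_0}\bar c)$. If $\|(r_p,r_d)\|_2\le C_N\frac{\mu_{k+1}}{\mu_0}$ and $\|(r_p,r_d)\|_{\mathcal A}\le\gamma_{\mathcal A}\rho\frac{\mu_{k+1}}{\mu_0}$, set $(\zeta_{k+1},\lambda_{k+1})=(x_{k+1},y_{k+1})$; otherwise $(\zeta_{k+1},\lambda_{k+1})=(\zeta_k,\lambda_k)$. *)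

(* Defs.v *)
From mathcomp Require Import all_boot all_order all_algebra.
From mathcomp Require Import all_classical all_reals topology normedtype.

Set Implicit Arguments.
Unset Strict Implicit.
Unset Printing Implicit Defensive.

Import Order.TTheory GRing.Theory Num.Theory.
Import numFieldNormedType.Exports.
Local Open Scope classical_set_scope.
Local Open Scope ring_scope.

(* Vectors are columns.  [`|v|] on matrices is the maximum of the absolute
   values of the entries; the Euclidean norm is [norm2]. *)

Definition dotv (R : realType) (n : nat) (u v : 'cV[R]_n) : R :=
  (u^T *m v) 0 0.

Definition norm2 (R : realType) (n : nat) (v : 'cV[R]_n) : R :=
  Num.sqrt (\sum_(i < n) v i 0 ^+ 2).

Definition nonneg_vec (R : realType) (n : nat) (v : 'cV[R]_n) : Prop :=
  forall i, 0 <= v i 0.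

Definition pos_vec (R : realType) (n : nat) (v : 'cV[R]_n) : Prop :=
  forall i, 0 < v i 0.

Definition ones (R : realType) (n : nat) : 'cV[R]_n := const_mx 1.

Definition diagv (R : realType) (n : nat) (v : 'cV[R]_n) : 'M[R]_n :=
  diag_mx v^T.

Definition sym_psd (R : realType) (n : nat) (Q : 'M[R]_n) : Prop :=
  Q^T = Q /\ forall v : 'cV[R]_n, 0 <= dotv v (Q *m v).

(* Only for m <= n, when A has m = min(m, n) singular values: the nonnegative
   square roots of the eigenvalues of the m x m matrix A A^T. *)
Definition singular_values (R : realType) (m n : nat) (A : 'M[R]_(m, n)) :
    set R :=
  [set s | 0 <= s /\ eigenvalue (A *m A^T) (s ^+ 2)].

(* These sets are finite, and nonempty in positive dimension, so that [inf] and
   [sup] are a minimum and a maximum. *)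
Definition eta_min (R : realType) (m n : nat) (A : 'M[R]_(m, n)) : R :=
  inf (singular_values A).

Definition eta_max (R : realType) (m n : nat) (A : 'M[R]_(m, n)) : R :=
  sup (singular_values A).

Definition nu_max (R : realType) (n : nat) (Q : 'M[R]_n) : R :=
  sup [set l | eigenvalue Q l].

Record qp (R : realType) (m n : nat) := QP {
  qp_A : 'M[R]_(m, n);
  qp_Q : 'M[R]_n;
  qp_b : 'cV[R]_m;
  qp_c : 'cV[R]_n }.

Definition primal_obj (R : realType) (m n : nat) (P : qp R m n)
    (x : 'cV[R]_n) : R :=
  dotv (qp_c P) x + 2^-1 * dotv x (qp_Q P *m x).

Definition primal_feasible (R : realType) (m n : nat) (P : qp R m n)
    (x : 'cV[R]_n) : Prop :=
  qp_A P *m x = qp_b P /\ nonneg_vec x.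

Definition primal_optimal (R : realType) (m n : nat) (P : qp R m n)
    (x : 'cV[R]_n) : Prop :=
  primal_feasible P x /\
  forall x', primal_feasible P x' -> primal_obj P x <= primal_obj P x'.

Definition dual_obj (R : realType) (m n : nat) (P : qp R m n)
    (x : 'cV[R]_n) (y : 'cV[R]_m) : R :=
  dotv (qp_b P) y - 2^-1 * dotv x (qp_Q P *m x).

(* The variable x of the dual problem is free. *)
Definition dual_feasible (R : realType) (m n : nat) (P : qp R m n)
    (x : 'cV[R]_n) (y : 'cV[R]_m) (z : 'cV[R]_n) : Prop :=
  - (qp_Q P *m x) + (qp_A P)^T *m y + z = qp_c P /\ nonneg_vec z.

Definition dual_optimal (R : realType) (m n : nat) (P : qp R m n)
    (x : 'cV[R]_n) (y : 'cV[R]_m) (z : 'cV[R]_n) : Prop :=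
  dual_feasible P x y z /\
  forall x' y' z', dual_feasible P x' y' z' ->
    dual_obj P x' y' <= dual_obj P x y.

Definition primal_dual_optimal (R : realType) (m n : nat) (P : qp R m n)
    (x : 'cV[R]_n) (y : 'cV[R]_m) (z : 'cV[R]_n) : Prop :=
  primal_optimal P x /\ dual_optimal P x y z.

(* The infimum is over a nonempty set, and attained, when A has full row
   rank. *)
Definition seminorm (R : realType) (m n : nat) (P : qp R m n)
    (b' : 'cV[R]_m) (c' : 'cV[R]_n) : R :=
  inf [set r | exists x y z,
         [/\ qp_A P *m x = b',
             - (qp_Q P *m x) + (qp_A P)^T *m y + z = c' &
             r = norm2 (col_mx x z)]].

Record ippmm_params (R : realType) := IPPMMParams {
  ip_rho : R;
  ip_CN : R;
  ip_gammaA : R;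
  ip_gammamu : R;
  ip_sigma_min : R;
  ip_sigma_max : R }.

Definition valid_params (R : realType) (prm : ippmm_params R) : Prop :=
  [/\ 0 < ip_rho prm, 0 < ip_CN prm,
      0 < ip_gammaA prm < 1, 0 < ip_gammamu prm < 1 &
      [/\ 0 < ip_sigma_min prm, ip_sigma_min prm <= ip_sigma_max prm &
          ip_sigma_max prm <= 2^-1]].

(* The starting point is (x0, y0, z0) with x0 = z0 = rho e_n, given by [start]
   below and the vector y0. *)
Definition start (R : realType) (n : nat) (prm : ippmm_params R) : 'cV[R]_n :=
  ip_rho prm *: ones R n.

Definition mu_of (R : realType) (n : nat) (x z : 'cV[R]_n) : R :=
  dotv x z / n%:R.

Definition mu0 (R : realType) (n : nat) (prm : ippmm_params R) : R :=
  mu_of (start n prm) (start n prm).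

Definition bbar (R : realType) (m n : nat) (P : qp R m n)
    (prm : ippmm_params R) : 'cV[R]_m :=
  qp_A P *m start n prm - qp_b P.

Definition cbar (R : realType) (m n : nat) (P : qp R m n)
    (prm : ippmm_params R) (y0 : 'cV[R]_m) : 'cV[R]_n :=
  - (qp_Q P *m start n prm) + (qp_A P)^T *m y0 + start n prm - qp_c P.

Definition neighbourhood (R : realType) (m n : nat) (P : qp R m n)
    (prm : ippmm_params R) (y0 : 'cV[R]_m)
    (mu : R) (zeta : 'cV[R]_n) (lam : 'cV[R]_m)
    (x : 'cV[R]_n) (y : 'cV[R]_m) (z : 'cV[R]_n) : Prop :=
  [/\ pos_vec x, pos_vec z,
      forall i, ip_gammamu prm * mu <= x i 0 * z i 0 &
      exists (bt : 'cV[R]_m) (ct : 'cV[R]_n),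
        [/\ norm2 (col_mx bt ct) <= ip_CN prm,
            seminorm P bt ct <= ip_gammaA prm * ip_rho prm,
            qp_A P *m x + mu *: (y - lam) =
              qp_b P + (mu / mu0 n prm) *: (bbar P prm + bt) &
            - (qp_Q P *m x) + (qp_A P)^T *m y + z - mu *: (x - zeta) =
              qp_c P + (mu / mu0 n prm) *: (cbar P prm y0 + ct)]].

Record state (R : realType) (m n : nat) := State {
  st_x : 'cV[R]_n;
  st_y : 'cV[R]_m;
  st_z : 'cV[R]_n;
  st_zeta : 'cV[R]_n;
  st_lam : 'cV[R]_m }.

Definition init_state (R : realType) (m n : nat) (prm : ippmm_params R)
    (y0 : 'cV[R]_m) : state R m n :=
  State (start n prm) y0 (start n prm) (start n prm) y0.

Definition newton_direction (R : realType) (m n : nat) (P : qp R m n)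
    (prm : ippmm_params R) (y0 : 'cV[R]_m) (s : state R m n) (sigma : R)
    (dx : 'cV[R]_n) (dy : 'cV[R]_m) (dz : 'cV[R]_n) : Prop :=
  let: State x y z zeta lam := s in
  let mu := mu_of x z in
  [/\ - ((qp_Q P + mu%:M) *m dx) + (qp_A P)^T *m dy + dz =
        (qp_c P + (sigma * mu / mu0 n prm) *: cbar P prm y0)
        + qp_Q P *m x - (qp_A P)^T *m y - z + (sigma * mu) *: (x - zeta),
      qp_A P *m dx + mu *: dy =
        (qp_b P + (sigma * mu / mu0 n prm) *: bbar P prm)
        - qp_A P *m x - (sigma * mu) *: (y - lam) &
      diagv z *m dx + diagv x *m dz =
        - (diagv x *m diagv z *m ones R n) + (sigma * mu) *: ones R n].

Definition admissible_step (R : realType) (m n : nat) (P : qp R m n)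
    (prm : ippmm_params R) (y0 : 'cV[R]_m) (s : state R m n)
    (dx : 'cV[R]_n) (dy : 'cV[R]_m) (dz : 'cV[R]_n) (a : R) : Prop :=
  let: State x y z zeta lam := s in
  let mua := mu_of (x + a *: dx) (z + a *: dz) in
  [/\ 0 < a <= 1, mua <= (1 - a / 100%:R) * mu_of x z &
      neighbourhood P prm y0 mua zeta lam
        (x + a *: dx) (y + a *: dy) (z + a *: dz)].

Definition max_step (R : realType) (m n : nat) (P : qp R m n)
    (prm : ippmm_params R) (y0 : 'cV[R]_m) (s : state R m n)
    (dx : 'cV[R]_n) (dy : 'cV[R]_m) (dz : 'cV[R]_n) (a : R) : Prop :=
  admissible_step P prm y0 s dx dy dz a /\
  forall a', admissible_step P prm y0 s dx dy dz a' -> a' <= a.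

(* The test deciding whether the estimates zeta and lambda are updated. *)
Definition update_test (R : realType) (m n : nat) (P : qp R m n)
    (prm : ippmm_params R) (y0 : 'cV[R]_m)
    (x : 'cV[R]_n) (y : 'cV[R]_m) (z : 'cV[R]_n) : Prop :=
  let t := mu_of x z / mu0 n prm in
  let rp := qp_A P *m x - (qp_b P + t *: bbar P prm) in
  let rd := - (qp_Q P *m x) + (qp_A P)^T *m y + z
            - (qp_c P + t *: cbar P prm y0) in
  norm2 (col_mx rp rd) <= ip_CN prm * t /\
  seminorm P rp rd <= ip_gammaA prm * ip_rho prm * t.

Definition ippmm_step (R : realType) (m n : nat) (P : qp R m n)
    (prm : ippmm_params R) (y0 : 'cV[R]_m) (s s' : state R m n) : Prop :=
  exists (sigma a : R) (dx : 'cV[R]_n) (dy : 'cV[R]_m) (dz : 'cV[R]_n),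
    [/\ ip_sigma_min prm <= sigma <= ip_sigma_max prm,
        newton_direction P prm y0 s sigma dx dy dz,
        max_step P prm y0 s dx dy dz a,
        [/\ st_x s' = st_x s + a *: dx,
            st_y s' = st_y s + a *: dy &
            st_z s' = st_z s + a *: dz] &
        (update_test P prm y0 (st_x s') (st_y s') (st_z s') ->
           st_zeta s' = st_x s' /\ st_lam s' = st_y s') /\
        (~ update_test P prm y0 (st_x s') (st_y s') (st_z s') ->
           st_zeta s' = st_zeta s /\ st_lam s' = st_lam s)].

(* No stopping tolerance: the iteration is continued indefinitely. *)
Definition ippmm_run (R : realType) (m n : nat) (P : qp R m n)
    (prm : ippmm_params R) (y0 : 'cV[R]_m) (s : nat -> state R m n) : Prop :=
  s 0%N = init_state n prm y0 /\
  forall k, ippmm_step P prm y0 (s k) (s k.+1).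

Definition iterates_limit_point (R : realType) (m n : nat) (s : nat -> state R m n)
    (x : 'cV[R]_n) (y : 'cV[R]_m) (z : 'cV[R]_n) : Prop :=
  cluster ((fun k => (st_x (s k), st_y (s k), st_z (s k))) @ \oo) (x, y, z).

(* Main.v *)
Require Import Defs.
From mathcomp Require Import all_boot all_order all_algebra.
From mathcomp Require Import all_classical all_reals topology normedtype.
From mathcomp Require Import ring lra.
Import Order.TTheory GRing.Theory Num.Theory.
Import numFieldNormedType.Exports.
Local Open Scope ring_scope.

(** Every accepted estimate (zeta, lambda), completed by the z at which the test
    succeeded, has infeasibility proportional to its mu, up to a relative
    perturbation of seminorm below gamma_A rho.  Comparing it by monotonicity of
    Q with the convex combination of a complementary solution and the slightly
    perturbed starting point bounds all estimates at once; the complementarity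
    of the given optimal pair is strong duality, i.e. Farkas' lemma applied to
    the linearised primal problem.  If mu_k stayed away from 0, then near the
    limit point the iterates, hence the Newton directions, would be bounded, a
    fixed step length would always be admissible, and mu_k would decrease by a
    fixed amount infinitely often.  So mu_k tends to 0, and since the estimates
    are bounded the neighbourhood equations become the optimality conditions in
    the limit. *)

Set Implicit Arguments.
Unset Strict Implicit.
Unset Printing Implicit Defensive.

(** * Elementary inequalities between real numbers *)

Section Reals.
Context {R : realType}.

(** The minimum is capped by 1, which also supplies a value when [I] is empty. *)
Lemma exists_small_pos (I : finType) (f : I -> R) :
  (forall i, 0 < f i) -> exists2 t, 0 < t & forall i, t <= f i.
Proof.
move=> f0; exists (\big[Num.min/1]_i f i); last by move=> i; apply: bigmin_le.
by apply: lt_bigmin => // i _.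
Qed.

(** Dividing [p.2] by [1 + |p.1|] covers every sign of [p.1]. This serves to meet all conditions on
    a step length at once. *)
Lemma exists_small_scale (s : seq (R * R)) : (forall p, p \in s -> 0 < p.2) ->
  exists2 a, 0 < a & forall p, p \in s -> a * p.1 <= p.2.
Proof.
move=> s0; have [i|a a0 aP] := @exists_small_pos 'I_(size s)
    (fun i => (nth (0, 0) s i).2 / (1 + `|(nth (0, 0) s i).1|)).
  by rewrite divr_gt0 ?s0 ?mem_nth// ltr_pwDl.
exists a => // p /(nthP (0, 0))[i si <-]; have := aP (Ordinal si); rewrite /=.
rewrite ler_pdivlMr ?ltr_pwDl//; apply: le_trans.
by rewrite ler_pM2l// (le_trans (ler_norm _))// lerDr.
Qed.

(** Since [(p + q)^2 <= 2 (p^2 + q^2)], the quadratic left side dominates the linear right side.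
    This turns an energy estimate into a norm bound. *)
Lemma sqr_sum_le_bound (e M p q : R) : 0 < e -> 0 <= M -> 0 <= p -> 0 <= q ->
  e * (p ^+ 2 + q ^+ 2) <= M * (p + q) -> p + q <= 2 * M / e.
Proof.
move=> e0 M0 p0 q0 H; rewrite ler_pdivlMr//.
have [s0|s0] := ltP 0 (p + q); last first.
  by have -> : p + q = 0 by [lra]; rewrite mul0r mulr_ge0.
rewrite -(ler_pM2l s0).
have : 0 <= e * (p - q) ^+ 2 by rewrite mulr_ge0 ?sqr_ge0 ?ltW.
lra.
Qed.

(** Plays the role of the limit [e -> 0]: [e] is taken below a tolerance divided by [1 + |C|],
    whatever the sign of [C]. *)
Lemma le0_of_linear_bound (r C : R) :
  (forall e, 0 < e -> e <= 1 -> r <= C * e) -> r <= 0.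
Proof.
move=> H; apply/ler_addgt0Pr => e e0; rewrite add0r.
have C1 : 0 < 1 + `|C| by rewrite ltr_pwDl.
pose d := Num.min 1 (e / (1 + `|C|)).
have d0 : 0 < d by rewrite lt_min ltr01 divr_gt0.
have d1 : d <= 1 by rewrite ge_min lexx.
apply: le_trans (H d d0 d1) _.
have : d * (1 + `|C|) <= e by rewrite -ler_pdivlMr// ge_min lexx orbT.
apply: le_trans; rewrite mulrC ler_pM2l// (le_trans (ler_norm _))// lerDr//.
Qed.

End Reals.

(** * Vectors and norms *)

Section Vectors.
Context {R : realType}.

Lemma dotvE n (u v : 'cV[R]_n) : dotv u v = \sum_i u i 0 * v i 0.
Proof. by rewrite /dotv mxE; apply: eq_bigr => i _; rewrite mxE. Qed.

Lemma dotvC n (u v : 'cV[R]_n) : dotv u v = dotv v u.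
Proof. by rewrite !dotvE; apply: eq_bigr => i _; rewrite mulrC. Qed.

Lemma dotvDr n (u v w : 'cV[R]_n) : dotv u (v + w) = dotv u v + dotv u w.
Proof. by rewrite /dotv mulmxDr mxE. Qed.

Lemma dotvZr n (u v : 'cV[R]_n) a : dotv u (a *: v) = a * dotv u v.
Proof. by rewrite /dotv -scalemxAr mxE. Qed.

Lemma dotvNr n (u v : 'cV[R]_n) : dotv u (- v) = - dotv u v.
Proof. by rewrite /dotv mulmxN mxE. Qed.

Lemma dotvBr n (u v w : 'cV[R]_n) : dotv u (v - w) = dotv u v - dotv u w.
Proof. by rewrite dotvDr dotvNr. Qed.

Lemma dotvDl n (u v w : 'cV[R]_n) : dotv (u + v) w = dotv u w + dotv v w.
Proof. by rewrite dotvC dotvDr !(dotvC w). Qed.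

Lemma dotvZl n (u v : 'cV[R]_n) a : dotv (a *: u) v = a * dotv u v.
Proof. by rewrite dotvC dotvZr dotvC. Qed.

Lemma dotvNl n (u v : 'cV[R]_n) : dotv (- u) v = - dotv u v.
Proof. by rewrite dotvC dotvNr dotvC. Qed.

Lemma dotvBl n (u v w : 'cV[R]_n) : dotv (u - v) w = dotv u w - dotv v w.
Proof. by rewrite dotvDl dotvNl. Qed.

Lemma dotv0l n (u : 'cV[R]_n) : dotv 0 u = 0.
Proof. by rewrite /dotv trmx0 mul0mx mxE. Qed.

Lemma dotv_mulmx m n (A : 'M[R]_(m, n)) u v :
  dotv u (A *m v) = dotv (A^T *m u) v.
Proof. by rewrite /dotv trmx_mul trmxK mulmxA. Qed.

Lemma diagv_mulmx n (u v : 'cV[R]_n) i : (diagv u *m v) i 0 = u i 0 * v i 0.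
Proof. by rewrite /diagv mul_diag_mx !mxE. Qed.

Lemma le_entry_norm m (v : 'cV[R]_m) i : `|v i 0| <= `|v|.
Proof.
by rewrite [leRHS]/Num.Def.normr /= mx_normrE; apply/bigmax_geP; right; exists (i, 0).
Qed.

Lemma norm_le_entries m n (M : 'M[R]_(m, n)) K :
  0 <= K -> (forall i j, `|M i j| <= K) -> `|M| <= K.
Proof.
move=> K0 H; rewrite [leLHS]/Num.Def.normr /= mx_normrE; apply/bigmax_leP.
by split=> // -[i j] _; apply: H.
Qed.

Lemma norm_cV_le m (v : 'cV[R]_m) K :
  0 <= K -> (forall i, `|v i 0| <= K) -> `|v| <= K.
Proof. by move=> K0 H; apply: norm_le_entries => // i j; rewrite ord1. Qed.

Lemma norm_dotv_le n (u v : 'cV[R]_n) : `|dotv u v| <= n%:R * (`|u| * `|v|).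
Proof.
rewrite dotvE (le_trans (ler_norm_sum _ _ _))//.
rewrite -[X in X%:R * _]card_ord mulr_natl -sumr_const ler_sum// => i _.
by rewrite normrM ler_pM// le_entry_norm.
Qed.

Lemma norm_mulmx_le m n (A : 'M[R]_(m, n)) (v : 'cV[R]_n) :
  `|A *m v| <= n%:R * `|A| * `|v|.
Proof.
apply: norm_cV_le => [|i]; first by rewrite !mulr_ge0.
rewrite mxE (le_trans (ler_norm_sum _ _ _))//.
rewrite -[X in X%:R * _]card_ord mulr_natl mulrnAl -sumr_const.
rewrite ler_sum// => j _.
rewrite normrM ler_pM// ?le_entry_norm//.
by rewrite [leRHS]/Num.Def.normr /= mx_normrE; apply/bigmax_geP; right; exists (i, j).
Qed.

Lemma norm2_sqr n (v : 'cV[R]_n) : norm2 v ^+ 2 = \sum_i v i 0 ^+ 2.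
Proof. by rewrite sqr_sqrtr// sumr_ge0// => i _; rewrite sqr_ge0. Qed.

Lemma norm2_ge0 n (v : 'cV[R]_n) : 0 <= norm2 v.
Proof. exact: sqrtr_ge0. Qed.

Lemma le_norm_norm2 n (v : 'cV[R]_n) : `|v| <= norm2 v.
Proof.
apply: norm_cV_le => [|i]; first exact: norm2_ge0.
rewrite -[leLHS]ger0_norm// -ler_sqr ?nnegrE ?norm2_ge0//.
rewrite ger0_norm// norm2_sqr real_normK ?num_real// (bigD1 i)//= lerDl.
by rewrite sumr_ge0// => j _; rewrite sqr_ge0.
Qed.

Lemma norm2_le_norm n (v : 'cV[R]_n) : norm2 v <= n%:R * `|v|.
Proof.
have K0 : 0 <= n%:R * `|v| by rewrite mulr_ge0.
rewrite -ler_sqr ?nnegrE ?norm2_ge0// norm2_sqr.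
apply: (@le_trans _ _ (n%:R * `|v| ^+ 2)).
  rewrite -[X in X%:R * _]card_ord mulr_natl -sumr_const ler_sum// => i _.
  by rewrite -real_normK ?num_real// ler_sqr ?nnegrE// le_entry_norm.
rewrite exprMn ler_wpM2r ?sqr_ge0// -natrX ler_nat.
by case: n {v K0} => // n; rewrite leq_pmulr.
Qed.

Lemma norm2Z n a (v : 'cV[R]_n) : 0 <= a -> norm2 (a *: v) = a * norm2 v.
Proof.
move=> a0; rewrite /norm2; under eq_bigr do rewrite mxE exprMn.
by rewrite -mulr_sumr sqrtrM ?sqr_ge0// sqrtr_sqr ger0_norm.
Qed.

(** Cauchy-Schwarz: expanding the squared length of [|v| u - |u| v] gives twice [|u| |v|] times the
    difference of the two sides. *)
Lemma dotv_le_norm2 n (u v : 'cV[R]_n) : dotv u v <= norm2 u * norm2 v.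
Proof.
have sqrE (w : 'cV[R]_n) : norm2 w ^+ 2 = dotv w w.
  by rewrite norm2_sqr dotvE; apply: eq_bigr => i _; rewrite expr2.
have [u0|u0] := eqVneq (norm2 u) 0.
  suff -> : u = 0 by rewrite dotv0l mulr_ge0 ?norm2_ge0.
  by apply/eqP; rewrite -normr_le0 -u0 le_norm_norm2.
have [v0|v0] := eqVneq (norm2 v) 0.
  suff -> : v = 0 by rewrite dotvC dotv0l mulr_ge0 ?norm2_ge0.
  by apply/eqP; rewrite -normr_le0 -v0 le_norm_norm2.
have uv : 0 < norm2 u * norm2 v by rewrite mulr_gt0// lt_def ?u0 ?v0 norm2_ge0.
have : 0 <= norm2 (norm2 v *: u - norm2 u *: v) ^+ 2 by rewrite sqr_ge0.
rewrite sqrE !(dotvBl, dotvBr, dotvZl, dotvZr) (dotvC v u).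
have := sqrE u; have := sqrE v; move: (dotv u u) (dotv v v) => _ _ <- <- h.
have : 0 <= 2 * (norm2 u * norm2 v) * (norm2 u * norm2 v - dotv u v) by nra.
by rewrite pmulr_rge0 ?subr_ge0// mulr_gt0.
Qed.

Lemma norm2D n (u v : 'cV[R]_n) : norm2 (u + v) <= norm2 u + norm2 v.
Proof.
have sqrE (w : 'cV[R]_n) : norm2 w ^+ 2 = dotv w w.
  by rewrite norm2_sqr dotvE; apply: eq_bigr => i _; rewrite expr2.
rewrite -ler_sqr ?nnegrE ?addr_ge0 ?norm2_ge0//.
rewrite sqrE !(dotvDl, dotvDr) sqrrD !sqrE (dotvC v u).
have := dotv_le_norm2 u v; lra.
Qed.

Lemma norm2_0 n : norm2 (0 : 'cV[R]_n) = 0.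
Proof. by rewrite -(scale0r 0) norm2Z// mul0r. Qed.

(** Here and in the next three lemmas the bounds on the parts are free variables, so that
    [norm_bound] can follow the syntax of a vector expression. The constants it has to reach are
    written in the same shape. *)
Lemma norm_addW k (u v : 'cV[R]_k) a b : `|u| <= a -> `|v| <= b -> `|u + v| <= a + b.
Proof. by move=> ua vb; rewrite (le_trans (ler_normD _ _))// lerD. Qed.

Lemma norm_oppW k (u : 'cV[R]_k) a : `|u| <= a -> `|- u| <= a.
Proof. by rewrite normrN. Qed.

Lemma norm_scaleW k t (u : 'cV[R]_k) a b : `|t| <= a -> `|u| <= b -> `|t *: u| <= a * b.
Proof. by move=> ta ub; rewrite normrZ ler_pM. Qed.

Lemma norm_mulmxW k l (M : 'M[R]_(k, l)) (u : 'cV[R]_l) b :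
  `|u| <= b -> `|M *m u| <= l%:R * `|M| * b.
Proof. by move=> ub; rewrite (le_trans (norm_mulmx_le _ _))// ler_wpM2l// mulr_ge0. Qed.

Lemma sqr_norm_le_dotv k (u : 'cV[R]_k) : `|u| ^+ 2 <= dotv u u.
Proof.
have -> : dotv u u = norm2 u ^+ 2.
  by rewrite norm2_sqr dotvE; apply: eq_bigr => i _; rewrite expr2.
by rewrite ler_sqr ?nnegrE ?norm2_ge0// le_norm_norm2.
Qed.

Lemma entry_bound k (u : 'cV[R]_k) a i : `|u| <= a -> - a <= u i 0 <= a.
Proof. by move=> ua; rewrite -ler_norml (le_trans (le_entry_norm _ _)). Qed.

Lemma norm_nearW k (u v : 'cV[R]_k) e : `|u - v| <= e -> `|v| <= `|u| + e.
Proof.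
by move=> uv; rewrite -{1}(subKr u v) (le_trans (ler_normB _ _))// lerD2l.
Qed.

Lemma norm_le0_eq0 k (u : 'cV[R]_k) : `|u| <= 0 -> u = 0.
Proof. by rewrite normr_le0 => /eqP. Qed.

Lemma norm_colmxD p q (u : 'cV[R]_p) (v : 'cV[R]_q) : `|col_mx u v| <= `|u| + `|v|.
Proof.
apply: norm_cV_le => [|i]; first by rewrite addr_ge0.
rewrite mxE; case: splitP => j _; rewrite (le_trans (le_entry_norm _ _))//.
  by rewrite lerDl.
by rewrite lerDr.
Qed.

Lemma norm2_col_mx m n (u : 'cV[R]_m) (v : 'cV[R]_n) :
  norm2 (col_mx u v) ^+ 2 = norm2 u ^+ 2 + norm2 v ^+ 2.
Proof.
rewrite !norm2_sqr big_split_ord /=; congr (_ + _).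
  by apply: eq_bigr => i _; rewrite col_mxEu.
by apply: eq_bigr => i _; rewrite col_mxEd.
Qed.

Lemma norm_usub_le m n (u : 'cV[R]_m) (v : 'cV[R]_n) : `|u| <= norm2 (col_mx u v).
Proof.
rewrite (le_trans (le_norm_norm2 _))// -ler_sqr ?nnegrE ?norm2_ge0//.
by rewrite norm2_col_mx lerDl sqr_ge0.
Qed.

Lemma norm_dsub_le m n (u : 'cV[R]_m) (v : 'cV[R]_n) : `|v| <= norm2 (col_mx u v).
Proof.
rewrite (le_trans (le_norm_norm2 _))// -ler_sqr ?nnegrE ?norm2_ge0//.
by rewrite norm2_col_mx lerDr sqr_ge0.
Qed.

(* Bartl's induction: either [a ord0] is superfluous, or some [d1] separates [c]
   from the other [a i], and projecting along [d1] eliminates [a ord0]. *)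
Lemma farkas n k (a : 'I_k -> 'cV[R]_n) (c : 'cV[R]_n) :
  (forall d, (forall i, 0 <= dotv (a i) d) -> 0 <= dotv c d) ->
  exists l : 'I_k -> R, (forall i, 0 <= l i) /\ c = \sum_i l i *: a i.
Proof.
elim: k a c => [|k IHk] a c Hc.
  exists (fun=> 0); split=> //; rewrite big_ord0.
  (* With no generators every direction is allowed, and testing [- c] forces [c = 0]. *)
  have : 0 <= dotv c (- c) by apply: Hc => -[].
  rewrite dotvNr oppr_ge0 dotvE => cc.
  have sq j : true -> 0 <= c j 0 * c j 0 by rewrite -expr2 sqr_ge0.
  have /psumr_eq0P c0 : \sum_i c i 0 * c i 0 = 0.
    by apply: le_anti; rewrite cc sumr_ge0.
  apply/matrixP => i j; rewrite ord1 mxE.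
  by have /eqP := c0 sq i isT; rewrite mulf_eq0 orbb => /eqP.
pose a' i := a (lift ord0 i).
have [H|] := pselect (forall d, (forall i, 0 <= dotv (a' i) d) -> 0 <= dotv c d).
  have [l [l0 ->]] := IHk _ _ H.
  exists (fun i => if unlift ord0 i is Some j then l j else 0); split.
    by move=> i; case: unlift => [j|//]; apply: l0.
  rewrite big_ord_recl unlift_none scale0r add0r.
  by apply: eq_bigr => i _; rewrite liftK.
move=> /existsNP[d0 /not_implyP[a'd0 /negP]]; rewrite -ltNge => cd0.
have ad0 : dotv (a ord0) d0 < 0.
  rewrite ltNge; apply/negP => ad0; move: cd0; rewrite ltNge => /negP; apply.
  by apply: Hc => i; case: (unliftP ord0 i) => [j ->|->//]; apply: a'd0.
have t0 : 0 < - (dotv (a ord0) d0)^-1 by rewrite oppr_gt0 invr_lt0.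
(* [d0] is rescaled so that its product with [a ord0] becomes [-1]. *)
have [d1 [ad1 a'd1 cd1]] : exists d1, [/\ dotv (a ord0) d1 = - 1,
    forall i, 0 <= dotv (a' i) d1 & dotv c d1 <= 0].
  exists (- (dotv (a ord0) d0)^-1 *: d0); split=> [|i|].
  - by rewrite dotvZr mulNr mulVf// lt_eqF.
  - by rewrite dotvZr mulr_ge0// ltW.
  - by rewrite dotvZr pmulr_rle0// ltW.
(* The adjoint of [pr] sends [d] to [d + dotv (a ord0) d *: d1], which is orthogonal to [a ord0]; so
   the hypothesis on [c] passes to [pr c] and the remaining generators. *)
pose pr (v : 'cV[R]_n) : 'cV[R]_n := v + dotv v d1 *: a ord0.
have prE v d : dotv (pr v) d = dotv v (d + dotv (a ord0) d *: d1).
  by rewrite dotvDl dotvZl dotvDr dotvZr mulrC.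
have [d prd|l [l0 lE]] := IHk (pr \o a') (pr c).
  rewrite prE; apply: Hc => i; case: (unliftP ord0 i) => [j ->|->].
    by rewrite -prE; apply: prd.
  by rewrite dotvDr dotvZr ad1 mulrN1 subrr.
(* The weight of [a ord0] comes from unfolding [pr] in [lE]; it is nonnegative because [d1]
   separates [c] from the other generators. *)
exists (fun i => if unlift ord0 i is Some j then l j else
  \sum_j l j * dotv (a' j) d1 - dotv c d1); split.
  move=> i; case: unlift => [j|//]; first exact: l0.
  rewrite subr_ge0 (le_trans cd1)// sumr_ge0// => j _.
  by rewrite mulr_ge0.
rewrite big_ord_recl unlift_none.
rewrite (eq_bigr (fun j => l j *: a' j)) => [|j _]; last by rewrite liftK.
apply/(addIr (dotv c d1 *: a ord0)); rewrite -/(pr c) lE scalerBl.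
rewrite (eq_bigr (fun j => l j *: a' j + (l j * dotv (a' j) d1) *: a ord0)).
  by rewrite big_split /= -scaler_suml [RHS]addrAC subrK addrC.
by move=> j _; rewrite scalerDr scalerA.
Qed.

Lemma mxD_entry m n (M N : 'M[R]_(m, n)) i j : (M + N) i j = M i j + N i j.
Proof. by rewrite mxE. Qed.

Lemma mxN_entry m n (M : 'M[R]_(m, n)) i j : (- M) i j = - M i j.
Proof. by rewrite mxE. Qed.

Lemma mxZ_entry m n a (M : 'M[R]_(m, n)) i j : (a *: M) i j = a * M i j.
Proof. by rewrite mxE. Qed.

(* Unlike [mxE], this leaves the entries of matrix products folded. *)
Definition mxlinE := (mxD_entry, mxN_entry, mxZ_entry).

End Vectors.

Ltac norm_bound := repeat match goal with
  | |- is_true (`|_ + _| <= _) => apply: norm_addW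
  | |- is_true (`|- _| <= _) => apply: norm_oppW
  | |- is_true (`|_ *: _| <= _) => apply: norm_scaleW
  | |- is_true (`|_ *m _| <= _) => apply: norm_mulmxW
  end; try by [].

(** * Multipliers and complementarity of optimal pairs *)

Section QuadraticProgram.
Context {R : realType} {m n : nat} (P : qp R m n).
Hypothesis hQ : sym_psd (qp_Q P).

Lemma dotv_symQ (u v : 'cV[R]_n) : dotv u (qp_Q P *m v) = dotv v (qp_Q P *m u).
Proof. by rewrite dotv_mulmx (proj1 hQ) dotvC. Qed.

(** A short move along [d] stays feasible, so the objective cannot decrease; dividing its variation
    by the step length and letting that length tend to 0 leaves the gradient term. *)
Lemma primal_optimal_gradient (x d : 'cV[R]_n) : primal_optimal P x ->
  qp_A P *m d = 0 -> (forall i, x i 0 = 0 -> 0 <= d i 0) ->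
  0 <= dotv (qp_c P + qp_Q P *m x) d.
Proof.
move=> [[Axb x0] xopt] Ad0 d0.
(* Coordinates with [x i 0 = 0] move upwards; the others have room for a small step. *)
have [t t0 tP] : exists2 t, 0 < t & forall i, t * `|d i 0| <= x i 0 \/ 0 <= d i 0.
  have [i|t t0 tP] := @exists_small_pos _ _
      (fun i => if x i 0 == 0 then 1 else x i 0 / (1 + `|d i 0|)).
    case: ifPn => // xi0; rewrite divr_gt0 ?lt_def ?xi0 ?x0//.
    by rewrite -lt_def ltr_pwDl.
  exists t => // i; have := tP i; case: eqP => [/d0 di _|_]; first by right.
  rewrite ler_pdivlMr ?ltr_pwDl// => tx; left; apply: le_trans tx.
  by rewrite ler_pM2l// lerDr.
have step u : 0 < u -> u <= t ->
    0 <= dotv (qp_c P + qp_Q P *m x) d + u / 2 * dotv d (qp_Q P *m d).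
  move=> u0 ut; have /xopt : primal_feasible P (x + u *: d).
    split=> [|i]; first by rewrite mulmxDr -scalemxAr Ad0 scaler0 addr0.
    rewrite !mxE; have [tx|di] := tP i; last by rewrite addr_ge0 ?mulr_ge0 ?(ltW u0)// x0.
    have : - `|d i 0| <= d i 0 by rewrite lerNl -normrN ler_norm.
    have : u * `|d i 0| <= t * `|d i 0| by rewrite ler_wpM2r.
    by nra.
  rewrite /primal_obj mulmxDr -scalemxAr !(dotvDr, dotvDl, dotvZr, dotvZl).
  rewrite (dotv_symQ d x) (dotvC (_ *m _) d) (dotv_symQ d x) => h.
  rewrite -(pmulr_rge0 _ u0); move: h; rewrite -subr_ge0.
  by congr (0 <= _); field.
have qd := proj2 hQ d.
apply/ler_addgt0Pr => e e0.
(* The step [u] makes the second-order term at most the arbitrary tolerance [e]. *)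
pose q := dotv d (qp_Q P *m d) / 2.
have q0 : 0 <= q by rewrite divr_ge0.
pose u := Num.min t (e / (1 + q)).
have u0 : 0 < u by rewrite lt_min t0 divr_gt0// ltr_pwDl.
have ue : u * q <= e.
  have : u <= e / (1 + q) by rewrite ge_min lexx orbT.
  rewrite ler_pdivlMr ?ltr_pwDl//; nra.
have ut : u <= t by rewrite ge_min lexx.
have := step _ u0 ut; rewrite -mulrA (mulrC 2^-1) => h.
by rewrite (le_trans h)// lerD2l.
Qed.

Lemma primal_optimal_multipliers (x : 'cV[R]_n) : primal_optimal P x ->
  exists y z, dual_feasible P x y z /\ dotv x z = 0.
Proof.
move=> xopt.
(* Generators for Farkas: the rows of [A] with both signs, whose weights subtract to the free
   multiplier [y], and the unit vectors of the active bounds. Inactive bounds contribute the zero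
   vector, which keeps the index type fixed. *)
pose a (k : 'I_((m + m) + n)) : 'cV[R]_n :=
  match fintype.split k with
  | inl k' => match fintype.split k' with
              | inl i => (row i (qp_A P))^T
              | inr i => - (row i (qp_A P))^T
              end
  | inr j => (x j 0 == 0)%:R *: delta_mx j 0
  end.
have rowE i d : dotv (row i (qp_A P))^T d = (qp_A P *m d) i 0.
  by rewrite dotvE mxE; apply: eq_bigr => j _; rewrite !mxE.
have [d ad|l [l0 lE]] := @farkas _ _ _ a (qp_c P + qp_Q P *m x).
  apply: primal_optimal_gradient => //.
    apply/matrixP => i j; rewrite ord1 [RHS]mxE; apply: le_anti; apply/andP; split.
      have := ad (lshift n (rshift m i)).
      by rewrite /a !(unsplitK (inl _)) !(unsplitK (inr _)) dotvNl rowE oppr_ge0.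
    have := ad (lshift n (lshift m i)).
    by rewrite /a !(unsplitK (inl _)) rowE.
  move=> i xi; have := ad (rshift (m + m) i).
  rewrite /a !(unsplitK (inr _)) xi eqxx scale1r dotvE (bigD1 i)//= !mxE !eqxx mul1r.
  rewrite big1 ?addr0// => j ji; rewrite !mxE.
  by rewrite (negbTE ji) mul0r.
pose y : 'cV[R]_m := \col_i (l (lshift n (lshift m i)) - l (lshift n (rshift m i))).
pose z : 'cV[R]_n := \col_i (l (rshift (m + m) i) * (x i 0 == 0)%:R).
exists y, z; split; last first.
  rewrite dotvE big1// => i _; rewrite mxE.
  by case: eqP => [->|]; rewrite ?mul0r ?mulr0.
split; last by move=> i; rewrite mxE mulr_ge0.
rewrite -addrA (_ : _ *m y + z = qp_c P + qp_Q P *m x).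
  by rewrite addrCA addNr addr0.
rewrite lE !big_split_ord /=; congr (_ + _).
  apply/matrixP => i j; rewrite ord1 !mxE !summxE -big_split /=.
  apply: eq_bigr => k _; rewrite /a !(unsplitK (inl _)) !(unsplitK (inr _)) !mxE.
  by ring.
apply/matrixP => i j; rewrite ord1 mxE summxE (bigD1 i)//= big1 => [|k ki].
  by rewrite /a (unsplitK (inr _)) !mxE !eqxx mulr1 addr0.
by rewrite /a (unsplitK (inr _)) !mxE [i == _]eq_sym (negbTE ki) !mulr0.
Qed.

(** Compare with multipliers [y'], [z'] for the same [x]. Dual optimality gives [b^T y' <= b^T y],
    and [z - z' = A^T (y' - y)], so [x^T z = b^T (y' - y) <= 0]. *)
Lemma primal_dual_complementary (x : 'cV[R]_n) y z :
  primal_dual_optimal P x y z -> dotv x z = 0.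
Proof.
move=> [xopt [[dz z0] dopt]].
have [y' [z' [dz' xz']]] := primal_optimal_multipliers xopt.
have [Axb x0] := proj1 xopt.
have := dopt _ _ _ dz'; rewrite /dual_obj lerD2r => by'.
have zE : z = z' + (qp_A P)^T *m (y' - y).
  case: dz' => /(canRL (addKr _)) -> _; rewrite -dz mulmxBr.
  by apply/matrixP => i j; rewrite ![in RHS]mxE; ring.
apply: le_anti; apply/andP; split; last first.
  by rewrite dotvE sumr_ge0// => i _; rewrite mulr_ge0.
by rewrite zE dotvDr xz' add0r dotv_mulmx trmxK Axb dotvBr subr_le0.
Qed.

End QuadraticProgram.

(** * The seminorm *)

Section Seminorm.
Context {R : realType} {m n : nat}.

(** What the Euclidean norm and the seminorm have in common, so that both neighbourhood conditions
    on the perturbation are handled by one argument. *)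
Definition sublinear (N : 'cV[R]_m -> 'cV[R]_n -> R) : Prop :=
  [/\ forall b c b' c', N (b + b') (c + c') <= N b c + N b' c',
      forall t b c, 0 < t -> N (t *: b) (t *: c) <= t * N b c &
      exists2 K, 0 <= K & forall b c, N b c <= K * (`|b| + `|c|)].

Lemma norm2_sublinear : sublinear (fun b c => norm2 (col_mx b c)).
Proof.
split=> [b c b' c'|t b c t0|].
- by rewrite -add_col_mx norm2D.
- by rewrite -scale_col_mx norm2Z// ltW.
- exists (m + n)%:R => // b c; rewrite (le_trans (norm2_le_norm _))//.
  by rewrite ler_wpM2l// norm_colmxD.
Qed.

Variable P : qp R m n.

Lemma seminorm_le b c x y z :
  qp_A P *m x = b -> - (qp_Q P *m x) + (qp_A P)^T *m y + z = c ->
  seminorm P b c <= norm2 (col_mx x z).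
Proof.
move=> Ax Qx; apply: ge_inf; last by exists x, y, z.
by exists 0 => _ [x' [y' [z' [_ _ ->]]]]; exact: norm2_ge0.
Qed.

Hypothesis hrank : \rank (qp_A P) = m.

Lemma mulmx_pinvA : qp_A P *m pinvmx (qp_A P) = 1%:M.
Proof. by rewrite mulmxVp// /row_free hrank. Qed.

(** A preimage with [y = 0], where [z] absorbs the rest of the second equation. It shows that the
    infimum in [seminorm] is over a nonempty set, and bounds it. *)
Lemma pinvA_solves (b : 'cV[R]_m) (c : 'cV[R]_n) :
  qp_A P *m (pinvmx (qp_A P) *m b) = b /\
  - (qp_Q P *m (pinvmx (qp_A P) *m b)) + (qp_A P)^T *m (0 : 'cV[R]_m) +
    (c + qp_Q P *m (pinvmx (qp_A P) *m b)) = c.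
Proof.
split; first by rewrite mulmxA mulmx_pinvA mul1mx.
by rewrite mulmx0 addr0 addrCA addNr addr0.
Qed.

Lemma seminorm_lt b c r : seminorm P b c < r ->
  exists x y z, [/\ qp_A P *m x = b,
    - (qp_Q P *m x) + (qp_A P)^T *m y + z = c & norm2 (col_mx x z) < r].
Proof.
rewrite /seminorm; set S := (X in inf X) => h.
have hS : has_inf S.
  split; last by exists 0 => _ [x' [y' [z' [_ _ ->]]]]; exact: norm2_ge0.
  have [Ax Qx] := pinvA_solves b c.
  by eexists; do 3 eexists; split; [exact: Ax|exact: Qx|reflexivity].
have e0 : 0 < r - inf S by rewrite subr_gt0.
have [_ [x [y [z [Ax Qx ->]]]]] := inf_adherent e0 hS.
by rewrite addrC subrK => xz; exists x, y, z.
Qed.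

(** Near-minimisers can be added and scaled; the linear bound comes from the pseudo-inverse
    preimage. *)
Lemma seminorm_sublinear : sublinear (seminorm P).
Proof.
split=> [b c b' c'|t b c t0|].
- apply/ler_addgt0Pr => e e0.
  have [|x [y [z [Ax Qx xz]]]] := @seminorm_lt b c (seminorm P b c + e / 2).
    by rewrite ltrDl divr_gt0.
  have [|x' [y' [z' [Ax' Qx' xz']]]] := @seminorm_lt b' c' (seminorm P b' c' + e / 2).
    by rewrite ltrDl divr_gt0.
  have := norm2D (col_mx x z) (col_mx x' z'); rewrite add_col_mx => xxzz.
  have : seminorm P (b + b') (c + c') <= norm2 (col_mx (x + x') (z + z')).
    apply: (@seminorm_le _ _ _ (y + y')); first by rewrite mulmxDr Ax Ax'.
    rewrite -Qx -Qx' !mulmxDr; apply/matrixP => i j.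
    by rewrite ![in LHS]mxE ![in RHS]mxE; ring.
  lra.
- apply/ler_addgt0Pr => e e0.
  have [|x [y [z [Ax Qx xz]]]] := @seminorm_lt b c (seminorm P b c + e / t).
    by rewrite ltrDl divr_gt0.
  have : seminorm P (t *: b) (t *: c) <= norm2 (col_mx (t *: x) (t *: z)).
    apply: (@seminorm_le _ _ _ (t *: y)); first by rewrite -scalemxAr Ax.
    by rewrite -Qx -!scalemxAr !scalerDr scalerN.
  rewrite -scale_col_mx norm2Z; last exact: ltW.
  move=> /le_trans; apply.
  have -> : t * seminorm P b c + e = t * (seminorm P b c + e / t).
    by field; rewrite gt_eqF.
  by rewrite ler_pM2l//; apply: ltW.
- pose p := m%:R * `|pinvmx (qp_A P)|; pose q := n%:R * `|qp_Q P|.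
  have p0 : 0 <= p by rewrite mulr_ge0.
  have q0 : 0 <= q by rewrite mulr_ge0.
  exists ((n + n)%:R * (1 + p + q * p)) => [|b c].
    by rewrite mulr_ge0// ?addr_ge0// mulr_ge0.
  have [Ax Qx] := pinvA_solves b c.
  rewrite (le_trans (seminorm_le Ax Qx))// (le_trans (norm2_le_norm _))//.
  rewrite -mulrA ler_wpM2l//. rewrite (le_trans (norm_colmxD _ _))//.
  have h1 := norm_mulmx_le (pinvmx (qp_A P)) b.
  have h2 := norm_mulmx_le (qp_Q P) (pinvmx (qp_A P) *m b).
  have h3 := ler_normD c (qp_Q P *m (pinvmx (qp_A P) *m b)).
  rewrite -/p -/q in h1 h2.
  have := normr_ge0 b; have := normr_ge0 c.
  have := mulr_ge0 p0 (normr_ge0 c).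
  have := mulr_ge0 (mulr_ge0 q0 p0) (normr_ge0 c).
  have := ler_wpM2l q0 h1; lra.
Qed.

End Seminorm.

(** * Boundedness of the accepted estimates *)

Section AcceptedPoints.
Context {R : realType} {m n : nat} (P : qp R m n) (prm : ippmm_params R).
Context (y0 : 'cV[R]_m).
Hypothesis hQ : sym_psd (qp_Q P).
Hypothesis hrank : \rank (qp_A P) = m.
Hypothesis hprm : valid_params prm.
Hypothesis n_gt0 : (0 < n)%N.

Local Notation rho := (ip_rho prm).
Local Notation CN := (ip_CN prm).
Local Notation gA := (ip_gammaA prm).
Local Notation m0 := (mu0 n prm).

Lemma natn_gt0 : 0 < n%:R :> R. Proof. by rewrite ltr0n. Qed.

Lemma dotv_mu_of (x z : 'cV[R]_n) : dotv x z = n%:R * mu_of x z.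
Proof. by rewrite /mu_of mulrC divfK// gt_eqF// natn_gt0. Qed.

Lemma mu_of_gt0 (x z : 'cV[R]_n) : pos_vec x -> pos_vec z -> 0 < mu_of x z.
Proof.
move=> x0 z0; rewrite divr_gt0 ?natn_gt0// dotvE.
rewrite (bigD1 (Ordinal n_gt0))//= ltr_pwDl ?mulr_gt0// sumr_ge0// => i _.
by rewrite mulr_ge0// ltW.
Qed.

Lemma start_gt0 : pos_vec (start n prm).
Proof. by case: hprm => rho0 _ _ _ _ i; rewrite !mxE mulr1. Qed.

Lemma mu0_gt0 : 0 < m0.
Proof. by apply: mu_of_gt0; apply: start_gt0. Qed.

(** The product equals [(x - x')^T Q (x - x')], since the term in [y - y'] is paired with
    [A (x - x') = 0]. *)
Lemma feasible_pair_monotone (x x' : 'cV[R]_n) (y y' : 'cV[R]_m) z z' :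
  qp_A P *m x = qp_A P *m x' ->
  - (qp_Q P *m x) + (qp_A P)^T *m y + z =
    - (qp_Q P *m x') + (qp_A P)^T *m y' + z' ->
  0 <= dotv (x - x') (z - z').
Proof.
move=> Ax dx.
have -> : z - z' = qp_Q P *m (x - x') - (qp_A P)^T *m (y - y').
  rewrite !mulmxBr; apply/matrixP => i j; move/matrixP/(_ i j): dx.
  by rewrite !mxlinE; lra.
rewrite dotvBr [X in _ - X]dotv_mulmx trmxK (mulmxBr (qp_A P)) Ax subrr dotv0l subr0.
exact: (proj2 hQ).
Qed.

(** With [t = mu / mu0], both sides of the expanded monotonicity inequality carry a factor [t], so
    the bound does not degrade as [mu] tends to 0. *)
Lemma update_test_bounded (xs : 'cV[R]_n) ys zs : primal_dual_optimal P xs ys zs ->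
  exists2 K, 0 <= K & forall zeta lam z, pos_vec zeta -> pos_vec z ->
    mu_of zeta z <= m0 -> update_test P prm y0 zeta lam z ->
    `|zeta| <= K /\ `|lam| <= K.
Proof.
move=> opt.
have [[Axs xs0] _] := proj1 opt.
have [[dxs zs0] _] := proj2 opt.
have xzs := primal_dual_complementary hQ opt.
case: (hprm) => rho0 CN0 /andP[gA0 gA1] _ _.
(* The gap between [gA] and [g] lets an actual preimage replace the infimum; [e] is what the
   perturbation leaves of an entry [rho] of the starting point. *)
pose g := (1 + gA) / 2; have g0 : gA < g by rewrite /g; lra.
have g1 : g < 1 by rewrite /g; lra.
pose e := rho * (1 - g); have e0 : 0 < e by rewrite mulr_gt0// subr_gt0.
pose C := n%:R * m0 + \sum_i (2 * rho * (xs i 0 + zs i 0) + 4 * rho ^+ 2).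
pose K1 := C / e.
have C0 : 0 <= C.
  apply: addr_ge0; first by rewrite mulr_ge0// ltW// mu0_gt0.
  apply: sumr_ge0 => i _.
  by have := xs0 i; have := zs0 i; nra.
have K10 : 0 <= K1 by rewrite divr_ge0// ltW.
(* Bounds [y] through [A^T y], which the dual residual expresses by bounded terms. *)
pose K2 := n%:R * `|(pinvmx (qp_A P))^T| *
  (`|qp_c P| + `|cbar P prm y0| + CN + n%:R * `|qp_Q P| * K1 + K1).
have K20 : 0 <= K2.
  apply: mulr_ge0; first exact: mulr_ge0.
  have := ltW CN0; have := mulr_ge0 (mulr_ge0 (ler0n R n) (normr_ge0 (qp_Q P))) K10.
  have := normr_ge0 (qp_c P); have := normr_ge0 (cbar P prm y0).
  lra.
exists (K1 + K2); first exact: addr_ge0.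
move=> x y z x0 z0 mule.
rewrite /update_test; set t := mu_of x z / m0; set rp := _ - _; set rd := _ - _.
move=> [nrm semi].
have t0 : 0 < t by rewrite divr_gt0 ?mu0_gt0 ?mu_of_gt0.
have t1 : t <= 1 by rewrite ler_pdivrMr ?mul1r// mu0_gt0.
have [xh [yh [zh [Axh dxh xzh]]]] : exists x y z, [/\ qp_A P *m x = rp,
    - (qp_Q P *m x) + (qp_A P)^T *m y + z = rd & norm2 (col_mx x z) < g * rho * t].
  apply: (seminorm_lt hrank); apply: le_lt_trans semi _.
  by rewrite ltr_pM2r// ltr_pM2r.
pose xt := (1 - t) *: xs + t *: start n prm + xh.
pose yt := (1 - t) *: ys + t *: y0 + yh.
pose zt := (1 - t) *: zs + t *: start n prm + zh.
(* The comparison point has, by construction, the same primal and dual residuals as [x], [y],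
   [z]. *)
have mono : 0 <= dotv (x - xt) (z - zt).
  apply: (@feasible_pair_monotone _ _ y yt).
    rewrite /xt !mulmxDr -!(scalemxAr (1 - t)) -!(scalemxAr t) Axh Axs /rp /bbar.
    by apply/matrixP => i j; rewrite !mxlinE; ring.
  move: dxh; rewrite /rd /cbar -dxs /xt /yt /zt !mulmxDr.
  rewrite -!(scalemxAr (1 - t)) -!(scalemxAr t) => /matrixP dxh.
  apply/matrixP => i j; move: (dxh i j).
  by rewrite !mxlinE; lra.
have ent i : t * e * (x i 0 + z i 0) + (x - xt) i 0 * (z - zt) i 0 <=
    x i 0 * z i 0 + (1 - t) ^+ 2 * (xs i 0 * zs i 0) +
    t * (2 * rho * (xs i 0 + zs i 0) + 4 * rho ^+ 2).
  (* The entries of [w] are below [g * rho * t] in absolute value, so the perturbed starting point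
     stays positive, at scale [t]. *)
  have bnd (w : 'cV[R]_n) : `|w| <= norm2 (col_mx xh zh) -> 
      t * e <= t * rho + w i 0 <= t * (2 * rho).
    move=> /(le_trans (le_entry_norm w i))/le_lt_trans/(_ xzh).
    by rewrite ltr_norml /e => /andP[h1 h2]; apply/andP; split; nra.
  have /andP[] := bnd _ (norm_usub_le xh zh).
  have /andP[] := bnd _ (norm_dsub_le xh zh).
  have -> : (x - xt) i 0 = x i 0 - ((1 - t) * xs i 0 + (t * rho + xh i 0)).
    by rewrite !mxlinE [ones _ _ _ _]mxE mulr1; ring.
  have -> : (z - zt) i 0 = z i 0 - ((1 - t) * zs i 0 + (t * rho + zh i 0)).
    by rewrite !mxlinE [ones _ _ _ _]mxE mulr1; ring.
  move: (t * rho + xh i 0) (t * rho + zh i 0) => u v v1 v2 u1 u2.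
  have := x0 i; have := z0 i; have := xs0 i; have := zs0 i.
  move: (x i 0) (z i 0) (xs i 0) (zs i 0) => a b p q q0 p0 b0 a0.
  have t1' : 0 <= 1 - t by rewrite subr_ge0.
  have te : 0 < t * e by rewrite mulr_gt0.
  have H1 : t * e * a <= a * ((1 - t) * q + v).
    by have := mulr_ge0 t1' q0; nra.
  have H2 : t * e * b <= b * ((1 - t) * p + u).
    by have := mulr_ge0 t1' p0; nra.
  have H3 : (1 - t) * p * v <= t * (2 * rho) * p.
    have : (1 - t) * v <= t * (2 * rho).
      by rewrite (le_trans _ v2)// ler_piMl ?gerBl ?(ltW t0)// (le_trans (ltW te)).
    by move=> /(ler_wpM2r p0); rewrite mulrAC.
  have H4 : (1 - t) * q * u <= t * (2 * rho) * q.
    have : (1 - t) * u <= t * (2 * rho).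
      by rewrite (le_trans _ u2)// ler_piMl ?gerBl ?(ltW t0)// (le_trans (ltW te)).
    by move=> /(ler_wpM2r q0); rewrite mulrAC.
  have H5 : u * v <= t * (4 * rho ^+ 2).
    have : u * v <= (t * (2 * rho)) * (t * (2 * rho)).
      by apply: ler_pM => //; apply: le_trans (ltW te) _.
    move=> /le_trans; apply.
    have -> : t * (2 * rho) * (t * (2 * rho)) = t * t * (4 * rho ^+ 2) by ring.
    apply: ler_wpM2r; first by rewrite mulr_ge0 ?sqr_ge0.
    by rewrite ler_piMr// ltW.
  by lra.
(* Sum [ent] over [i]: the product in [mono] is dropped, complementarity removes the term in [xs]
   and [zs], [x^T z] is [n * t * mu0], and [t] cancels. *)
have sumK1 : \sum_i (x i 0 + z i 0) <= K1.
  rewrite ler_pdivlMr// mulrC -(ler_pM2l t0) mulrA.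
  have : \sum_i (t * e * (x i 0 + z i 0) + (x - xt) i 0 * (z - zt) i 0) <=
      \sum_i (x i 0 * z i 0 + (1 - t) ^+ 2 * (xs i 0 * zs i 0) +
    t * (2 * rho * (xs i 0 + zs i 0) + 4 * rho ^+ 2)) by apply: ler_sum.
  rewrite !big_split /= -!mulr_sumr -!dotvE xzs mulr0 addr0.
  rewrite (dotv_mu_of x z) -(_ : t * m0 = mu_of x z); last first.
    by rewrite divfK// gt_eqF// mu0_gt0.
  by rewrite -big_split /= /C; move: mono; lra.
have xz_le i : x i 0 <= K1 /\ z i 0 <= K1.
  have : x i 0 + z i 0 <= K1.
    apply: le_trans sumK1; rewrite [leRHS](bigD1 i)//= lerDl sumr_ge0// => j _.
    by rewrite addr_ge0// ltW.
  by have := x0 i; have := z0 i; split; lra.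
have xK : `|x| <= K1.
  by apply: norm_cV_le => // i; rewrite gtr0_norm// (xz_le i).1.
have zK : `|z| <= K1.
  by apply: norm_cV_le => // i; rewrite gtr0_norm// (xz_le i).2.
split; first by rewrite (le_trans xK)// lerDl.
rewrite (@le_trans _ _ K2)// ?lerDr//.
have -> : y = (pinvmx (qp_A P))^T *m ((qp_A P)^T *m y).
  by rewrite mulmxA -trmx_mul mulmx_pinvA// trmx1 mul1mx.
rewrite (le_trans (norm_mulmx_le _ _))// ler_wpM2l ?mulr_ge0//.
have -> : (qp_A P)^T *m y = qp_c P + t *: cbar P prm y0 + rd + qp_Q P *m x - z.
  by rewrite /rd; apply/matrixP => i j; rewrite !mxlinE; ring.
rewrite (le_trans (ler_normB _ _))// lerD//.
rewrite (le_trans (ler_normD _ _))// lerD//; last first.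
  by rewrite (le_trans (norm_mulmx_le _ _))// ler_wpM2l// mulr_ge0.
rewrite (le_trans (ler_normD _ _))// lerD//; last first.
  rewrite (le_trans (norm_dsub_le rp rd))// (le_trans nrm)//.
  by rewrite ler_piMr// ltW.
rewrite (le_trans (ler_normD _ _))// lerD//.
by rewrite normrZ gtr0_norm// ler_piMl.
Qed.

End AcceptedPoints.

(** * Newton directions and step lengths *)

Section NewtonStep.
Context {R : realType} {m n : nat} (P : qp R m n) (prm : ippmm_params R).
Context (y0 : 'cV[R]_m).
Hypothesis hQ : sym_psd (qp_Q P).
Hypothesis hprm : valid_params prm.
Hypothesis n_gt0 : (0 < n)%N.

Local Notation gm := (ip_gammamu prm).
Local Notation m0 := (mu0 n prm).
Local Notation mu := mu_of.

Section Bounded.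
Variables (B d : R).
Hypotheses (B_gt0 : 0 < B) (d_gt0 : 0 < d).

(** Describes iterates close to a limit point as long as [mu] stays above [d]. *)
Definition bounded_iterate (x : 'cV[R]_n) (y : 'cV[R]_m) (z zeta : 'cV[R]_n)
    (lam : 'cV[R]_m) : Prop :=
  [/\ pos_vec x, pos_vec z, forall i, gm * mu x z <= x i 0 * z i 0, d <= mu x z &
      [/\ `|x| <= B, `|y| <= B, `|z| <= B, `|zeta| <= B & `|lam| <= B]].

Local Notation beta := (gm * d / B).

Lemma beta_gt0 : 0 < beta.
Proof.
by case: hprm => _ _ _ /andP[gm0 _] _; rewrite divr_gt0// mulr_gt0.
Qed.

Lemma mu_le_sqr (x : 'cV[R]_n) z : `|x| <= B -> `|z| <= B -> `|mu x z| <= B ^+ 2.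
Proof.
move=> xB zB; rewrite normrM normfV normr_nat ler_pdivrMr ?natn_gt0//.
rewrite (le_trans (norm_dotv_le _ _))// mulrC ler_wpM2r//.
by rewrite expr2 ler_pM.
Qed.

Lemma bounded_iterate_ge x y z zeta lam : bounded_iterate x y z zeta lam ->
  forall i, beta <= x i 0 /\ beta <= z i 0.
Proof.
move=> [x0 z0 xz dmu [xB _ zB _ _]] i.
case: hprm => _ _ _ /andP[gm0 _] _.
have h : gm * d <= x i 0 * z i 0 by apply: le_trans (xz i); rewrite ler_pM2l.
have xiB : x i 0 <= B by rewrite (le_trans _ xB)// (le_trans (ler_norm _))// le_entry_norm.
have ziB : z i 0 <= B by rewrite (le_trans _ zB)// (le_trans (ler_norm _))// le_entry_norm.
rewrite !ler_pdivrMr//; have := x0 i; have := z0 i; split; nra.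
Qed.

(** The regularisation by [mu >= d] makes the Newton system coercive in [dx] and [dy]; the
    complementarity equation then controls [dz]. *)
Lemma newton_direction_bounded : exists2 D, 0 <= D &
  forall x y z zeta lam sigma dx dy dz, bounded_iterate x y z zeta lam ->
    0 <= sigma <= 1 -> newton_direction P prm y0 (State x y z zeta lam) sigma dx dy dz ->
    [/\ `|dx| <= D, `|dy| <= D & `|dz| <= D].
Proof.
(* [S] bounds [mu], [R1] and [R2] the right-hand sides of the first two equations, and [W] the part
   of [dz] that is free of [dx]. *)
pose S := B ^+ 2.
pose R1 := `|qp_c P| + S / m0 * `|cbar P prm y0| + n%:R * `|qp_Q P| * B
  + m%:R * `|(qp_A P)^T| * B + B + S * (B + B).
pose R2 := `|qp_b P| + S / m0 * `|bbar P prm| + n%:R * `|qp_A P| * B + S * (B + B).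
pose W := (S + S) / beta.
pose M := m%:R * R2 + n%:R * W + n%:R * R1.
pose D1 := 2 * M / d.
have m00 : 0 < m0 by apply: mu0_gt0.
have bt0 := beta_gt0.
have S0 : 0 <= S by rewrite sqr_ge0.
have W0 : 0 <= W by rewrite divr_ge0 ?addr_ge0// ltW.
have Sm0 : 0 <= S / m0 by rewrite divr_ge0// ltW.
have R10 : 0 <= R1.
  by do !(exact: Sm0 || exact: (ltW B_gt0) || apply: addr_ge0 || apply: mulr_ge0).
have R20 : 0 <= R2.
  by do !(exact: Sm0 || exact: (ltW B_gt0) || apply: addr_ge0 || apply: mulr_ge0).
have M0 : 0 <= M.
  by do !(exact: R10 || exact: R20 || exact: W0 || apply: addr_ge0 || apply: mulr_ge0).
have D10 : 0 <= D1 by rewrite divr_ge0 ?mulr_ge0// ltW.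
have BD : 0 <= B / beta * D1 by rewrite mulr_ge0// divr_ge0// ltW.
exists (D1 + (W + B / beta * D1)); first exact: addr_ge0 (addr_ge0 _ _).
move=> x y z zeta lam sigma dx dy dz bi /andP[s0 s1].
have xzb := bounded_iterate_ge bi.
case: bi => x0 z0 xz dmu [xB yB zB zetaB lamB].
rewrite /newton_direction -/(mu x z).
have muS := mu_le_sqr xB zB.
have mu0 : 0 < mu x z by apply: lt_le_trans dmu.
move: (mu x z) muS mu0 dmu xz => t tS t0 dt xz [E1 E2 E3].
have st : `|sigma * t| <= S.
  by rewrite normrM (ger0_norm s0) (le_trans _ tS)// ler_piMl.
have stm : `|sigma * t / m0| <= S / m0.
  by rewrite normrM normfV (gtr0_norm m00) ler_wpM2r// invr_ge0 ltW.
move: E1 E2; set r1 := (X in _ = X -> _); set r2 := (X in _ -> _ = X -> _) => E1 E2.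
have r1B : `|r1| <= R1 by rewrite /r1 /R1; norm_bound.
have r2B : `|r2| <= R2 by rewrite /r2 /R2; norm_bound.
(* Solving the third equation for [dz] gives [w] minus a nonnegative diagonal multiple of [dx]. *)
pose w : 'cV[R]_n := \col_i ((sigma * t - x i 0 * z i 0) / x i 0).
have wB : `|w| <= W.
  apply: norm_cV_le => // i; have [xb zb] := xzb i.
  rewrite mxE normrM normfV (gtr0_norm (x0 i)) ler_pM ?invr_ge0 ?(ltW (x0 i))//.
    rewrite (le_trans (ler_normB _ _))// lerD// normrM /S expr2 ler_pM//.
      by rewrite (le_trans (le_entry_norm _ _)).
    by rewrite (le_trans (le_entry_norm _ _)).
  by rewrite lef_pV2// posrE.
have dzE i : dz i 0 = w i 0 - z i 0 / x i 0 * dx i 0.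
  move/matrixP/(_ i 0): E3; rewrite -[diagv x *m _ *m _]mulmxA.
  rewrite ![in X in X -> _](mxlinE, diagv_mulmx) !mxE !mulr1 => E3.
  have xi0 : x i 0 != 0 by rewrite gt_eqF.
  by apply: (mulfI xi0); rewrite -[LHS](addrK (z i 0 * dx i 0)) [X in X - _]addrC E3; field.
have dxdz : dotv dx dz <= dotv dx w.
  rewrite !dotvE; apply: ler_sum => i _; rewrite dzE mulrBr gerBl.
  by rewrite mulrCA mulrA -mulrA -expr2 mulr_ge0 ?sqr_ge0// divr_ge0 ?ltW.
(* Pair the first Newton equation with [dx]; the other two eliminate [A dx] and
   [dz], and the terms in [Q] and [z / x] have a sign. *)
have energy : t * (dotv dx dx + dotv dy dy) <= dotv r2 dy + dotv dx w - dotv dx r1.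
  have := congr1 (dotv dx) E1.
  rewrite mulmxDl mul_scalar_mx !(dotvDr, dotvNr, dotvZr) [dotv dx (_ *m dy)]dotv_mulmx trmxK.
  rewrite (canRL (addrK _) E2) dotvBl dotvZl.
  have := proj2 hQ dx; lra.
have nrm : d * (`|dx| ^+ 2 + `|dy| ^+ 2) <= M * (`|dx| + `|dy|).
  apply: (@le_trans _ _ (t * (dotv dx dx + dotv dy dy))).
    apply: ler_pM => //; first exact: ltW.
      by rewrite addr_ge0// sqr_ge0.
    by rewrite lerD// sqr_norm_le_dotv.
  apply: le_trans energy _.
  have h1 : dotv r2 dy <= m%:R * (R2 * `|dy|).
    rewrite (le_trans (ler_norm _))// (le_trans (norm_dotv_le _ _))//.
    by rewrite ler_wpM2l// ler_wpM2r.
  have h2 : dotv dx w <= n%:R * (W * `|dx|).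
    rewrite dotvC (le_trans (ler_norm _))// (le_trans (norm_dotv_le _ _))//.
    by rewrite ler_wpM2l// ler_wpM2r.
  have h3 : - dotv dx r1 <= n%:R * (R1 * `|dx|).
    rewrite dotvC (le_trans (ler_norm _))// normrN (le_trans (norm_dotv_le _ _))//.
    by rewrite ler_wpM2l// ler_wpM2r.
  have h4 : 0 <= m%:R * (R2 * `|dx|) by rewrite mulr_ge0// mulr_ge0.
  have h5 : 0 <= n%:R * (W * `|dy|) by rewrite mulr_ge0// mulr_ge0.
  have h6 : 0 <= n%:R * (R1 * `|dy|) by rewrite mulr_ge0// mulr_ge0.
  by rewrite /M; lra.
have D1B : `|dx| + `|dy| <= D1 by apply: sqr_sum_le_bound.
have dx0 := normr_ge0 dx; have dy0 := normr_ge0 dy.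
have dxB : `|dx| <= D1 by move: D1B dy0; clear; lra.
have dyB : `|dy| <= D1 by move: D1B dx0; clear; lra.
have D1D : D1 <= D1 + (W + B / beta * D1) by rewrite lerDl addr_ge0.
split; [exact: le_trans D1D|exact: le_trans D1D|].
apply: (@le_trans _ _ (W + B / beta * D1)); last by rewrite lerDr.
apply: norm_cV_le => [|i]; first exact: addr_ge0.
have [xb zb] := xzb i; rewrite dzE (le_trans (ler_normB _ _))// lerD//.
  by rewrite (le_trans (le_entry_norm _ _)).
rewrite normrM ler_pM//; last by rewrite (le_trans (le_entry_norm _ _)).
rewrite normrM normfV (gtr0_norm (x0 i)) ler_pM ?invr_ge0 ?(ltW (x0 i))//.
  by rewrite (le_trans (le_entry_norm _ _)).
by rewrite lef_pV2// posrE.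
Qed.

End Bounded.
End NewtonStep.

(** * A step length that is admissible uniformly on bounded iterates *)

Section StepLength.
Context {R : realType} {m n : nat} (P : qp R m n) (prm : ippmm_params R).
Context (y0 : 'cV[R]_m).
Hypothesis hQ : sym_psd (qp_Q P).
Hypothesis hrank : \rank (qp_A P) = m.
Hypothesis hprm : valid_params prm.
Hypothesis n_gt0 : (0 < n)%N.

Local Notation rho := (ip_rho prm).
Local Notation CN := (ip_CN prm).
Local Notation gA := (ip_gammaA prm).
Local Notation gm := (ip_gammamu prm).
Local Notation m0 := (mu0 n prm).
Local Notation mu := mu_of.

(** Contracting the old perturbation by [1 - a] while [ta] keeps the extra [a * sg * t] leaves slack
    of order [a], which absorbs the terms of order [a ^+ 2]. The last hypothesis is this comparison
    divided by [a]. *)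
Lemma sublinear_step (N : 'cV[R]_m -> 'cV[R]_n -> R) C E K (a sg t ta q c0 : R)
    bt ct ep ed :
  (forall b c b' c', N (b + b') (c + c') <= N b c + N b' c') ->
  (forall s b c, 0 < s -> N (s *: b) (s *: c) <= s * N b c) ->
  (forall b c, N b c <= K * (`|b| + `|c|)) ->
  0 <= K -> 0 < C -> 0 < c0 -> 0 < a -> a < 1 -> 0 < t -> 0 < ta ->
  ta = (1 - a + a * sg) * t + a ^+ 2 * q ->
  N bt ct <= C -> `|ep| <= E -> `|ed| <= E ->
  a * (K * (E + E) * c0 + C * `|q|) <= C * (sg * t) ->
  N ((c0 / ta) *: (((1 - a) * (t / c0)) *: bt + a ^+ 2 *: ep))
    ((c0 / ta) *: (((1 - a) * (t / c0)) *: ct + a ^+ 2 *: ed)) <= C.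
Proof.
move=> ND NZ NK K0 C0 c00 a0 a1 t0 ta0 taE NC epE edE small.
apply: le_trans (NZ _ _ _ _) _; first by rewrite divr_gt0.
have -> : C = c0 / ta * (C * (ta / c0)) by field; rewrite !gt_eqF.
rewrite ler_pM2l ?divr_gt0//; apply: le_trans (ND _ _ _ _) _.
have h1 : N (((1 - a) * (t / c0)) *: bt) (((1 - a) * (t / c0)) *: ct) <=
    (1 - a) * (t / c0) * C.
  have p0 : 0 < (1 - a) * (t / c0) by rewrite mulr_gt0 ?divr_gt0 ?subr_gt0.
  by apply: le_trans (NZ _ _ _ p0) _; rewrite ler_pM2l.
have h2 : N (a ^+ 2 *: ep) (a ^+ 2 *: ed) <= a ^+ 2 * (K * (E + E)).
  have p0 : 0 < a ^+ 2 by rewrite exprn_gt0.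
  apply: le_trans (NZ _ _ _ p0) _; rewrite ler_pM2l//.
  by apply: le_trans (NK _ _) _; rewrite ler_wpM2l// lerD.
apply: le_trans (lerD h1 h2) _.
have q0 : - `|q| <= q by rewrite lerNl -normrN ler_norm.
rewrite -(ler_pM2l c00).
have -> : c0 * ((1 - a) * (t / c0) * C + a ^+ 2 * (K * (E + E))) =
    (1 - a) * t * C + a * (a * (K * (E + E) * c0)) by field; rewrite gt_eqF.
have -> : c0 * (C * (ta / c0)) = C * ta by field; rewrite gt_eqF.
have h3 := ler_wpM2l (ltW a0) small.
have h4 : C * (a ^+ 2 * - `|q|) <= C * (a ^+ 2 * q) by rewrite !ler_wpM2l ?sqr_ge0// ltW.
by rewrite taE; lra.
Qed.

(* The part of the new perturbation that is linear in [a] is the old one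
   contracted by [1 - a]; the rest is of order [a ^+ 2], with [q] the mean of
   [dx i * dz i]. *)
Lemma primal_residual_step (b' bb bt y' : 'cV[R]_m) k (A' : 'M[R]_(m, k)) x' dx' dy' lam
    (a sg t ta q c0 : R) :
  c0 != 0 -> ta != 0 -> ta = (1 - a + a * sg) * t + a ^+ 2 * q ->
  A' *m x' + t *: (y' - lam) = b' + (t / c0) *: (bb + bt) ->
  A' *m dx' + t *: dy' = b' + (sg * t / c0) *: bb - A' *m x' - (sg * t) *: (y' - lam) ->
  A' *m (x' + a *: dx') + ta *: (y' + a *: dy' - lam) =
  b' + (ta / c0) *: (bb + (c0 / ta) *: (((1 - a) * (t / c0)) *: bt + a ^+ 2 *:
     (q *: (y' - lam) - (q / c0) *: bb + ((sg - 1) * t + a * q) *: dy'))).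
Proof.
move=> c0n tan taE /(canRL (addrK _)) Ax /(canRL (addrK _)) Adx.
rewrite mulmxDr -scalemxAr Adx Ax.
apply/matrixP => i j; rewrite !mxlinE.
have cancel u : ta / c0 * (c0 / ta * u) = u by field; rewrite ?c0n ?tan.
rewrite (mulrDr (ta / c0)) cancel.
by rewrite taE; field.
Qed.

(** The same splitting as for the primal residual; the proximal term has the opposite sign. *)
Lemma dual_residual_step (c' cb ct x' dx' z' dz' zeta : 'cV[R]_n) (y' dy' : 'cV[R]_m)
    (a sg t ta q c0 : R) :
  c0 != 0 -> ta != 0 -> ta = (1 - a + a * sg) * t + a ^+ 2 * q ->
  - (qp_Q P *m x') + (qp_A P)^T *m y' + z' - t *: (x' - zeta) =
    c' + (t / c0) *: (cb + ct) ->
  - ((qp_Q P + t%:M) *m dx') + (qp_A P)^T *m dy' + dz' =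
    (c' + (sg * t / c0) *: cb) + qp_Q P *m x' - (qp_A P)^T *m y' - z'
      + (sg * t) *: (x' - zeta) ->
  - (qp_Q P *m (x' + a *: dx')) + (qp_A P)^T *m (y' + a *: dy') + (z' + a *: dz')
    - ta *: (x' + a *: dx' - zeta) =
  c' + (ta / c0) *: (cb + (c0 / ta) *: (((1 - a) * (t / c0)) *: ct + a ^+ 2 *:
     (- (q *: (x' - zeta)) - (q / c0) *: cb - ((sg - 1) * t + a * q) *: dx'))).
Proof.
move=> c0n tan taE /matrixP H /matrixP D.
rewrite !mulmxDr -!scalemxAr; apply/matrixP => i j.
move: (H i j) (D i j); rewrite mulmxDl mul_scalar_mx !mxlinE.
have cancel u : ta / c0 * (c0 / ta * u) = u by field; rewrite ?c0n ?tan.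
rewrite (mulrDr (ta / c0)) cancel.
move: ((qp_Q P *m x') i j) ((qp_Q P *m dx') i j) => Qx Qdx.
move: (((qp_A P)^T *m y') i j) (((qp_A P)^T *m dy') i j) => Ay Ady.
move=> /(canRL (subrK _)) /(canRL (addKr _)) -> /(canRL (addKr _)) ->.
by rewrite taE; field.
Qed.

(** The third Newton equation prescribes the part of each product that is linear in [a]. *)
Lemma mu_of_step (x' z' dx' dz' : 'cV[R]_n) (a sg : R) :
  diagv z' *m dx' + diagv x' *m dz' =
    - (diagv x' *m diagv z' *m ones R n) + (sg * mu x' z') *: ones R n ->
  mu (x' + a *: dx') (z' + a *: dz') =
    (1 - a + a * sg) * mu x' z' + a ^+ 2 * mu dx' dz' /\
  forall i, (x' + a *: dx') i 0 * (z' + a *: dz') i 0 =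
    (1 - a) * (x' i 0 * z' i 0) + a * sg * mu x' z' + a ^+ 2 * (dx' i 0 * dz' i 0).
Proof.
move=> /matrixP E.
have ent i : (x' + a *: dx') i 0 * (z' + a *: dz') i 0 =
    (1 - a) * (x' i 0 * z' i 0) + a * sg * mu x' z' + a ^+ 2 * (dx' i 0 * dz' i 0).
  move: (E i 0); rewrite -mulmxA !(mxlinE, diagv_mulmx) [ones _ _ _ _]mxE !mulr1.
  by move=> /(canRL (addrK _)) H; ring: H.
split=> //; rewrite /mu_of [in LHS]dotvE (eq_bigr _ (fun i _ => ent i)).
rewrite !big_split /= -!mulr_sumr -!dotvE sumr_const card_ord.
have n0 : n%:R != 0 :> R by rewrite gt_eqF// natn_gt0.
by rewrite -mulr_natl; field.
Qed.

Lemma admissible_uniform (B d : R) : 0 < B -> 0 < d -> exists2 a, 0 < a &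
  forall x y z zeta lam sigma dx dy dz,
    bounded_iterate prm B d x y z zeta lam ->
    neighbourhood P prm y0 (mu x z) zeta lam x y z ->
    ip_sigma_min prm <= sigma <= ip_sigma_max prm ->
    newton_direction P prm y0 (State x y z zeta lam) sigma dx dy dz ->
    admissible_step P prm y0 (State x y z zeta lam) dx dy dz a.
Proof.
move=> B0 d0.
have [rho0 CN0 /andP[gA0 gA1] /andP[gm0 gm1] [sm0 smM sM]] := hprm.
have m00 : 0 < m0 by apply: mu0_gt0.
have [D D0 DP] := newton_direction_bounded y0 hQ hprm n_gt0 B0 d0.
have [n2D n2Z [K1 K10 n2K]] := @norm2_sublinear R m n.
have [snD snZ [K2 K20 snK]] := seminorm_sublinear hrank.
(* [E1] and [E2] bound the second-order remainders of the two residuals, in the shape of [ep] and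
   [ed] below. *)
pose E1 := D ^+ 2 * (B + B) + D ^+ 2 / m0 * `|bbar P prm| + (B ^+ 2 + D ^+ 2) * D.
pose E2 := D ^+ 2 * (B + B) + D ^+ 2 / m0 * `|cbar P prm y0| + (B ^+ 2 + D ^+ 2) * D.
pose E := E1 + E2; pose sm := ip_sigma_min prm.
pose C1 := CN; pose C2 := gA * rho.
have C20 : 0 < C2 by rewrite mulr_gt0.
have E10 : 0 <= E1.
  by rewrite !addr_ge0// !mulr_ge0 ?invr_ge0 ?addr_ge0 ?sqr_ge0 ?(ltW B0) ?(ltW m00).
have E20 : 0 <= E2.
  by rewrite !addr_ge0// !mulr_ge0 ?invr_ge0 ?addr_ge0 ?sqr_ge0 ?(ltW B0) ?(ltW m00).
(* In order: [a < 1]; decrease of [mu], where [49 / 100 = 1 - 1 / 2 - 1 / 100] with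
   [sigma <= 1 / 2]; centrality; positivity; the Euclidean bound and the seminorm bound on the new
   perturbation. *)
pose conds := [:: (1, 2^-1); (100 * D ^+ 2, 49 * d); (2 * D ^+ 2, (1 - gm) * (sm * d));
  (2 * D, gm * d / B);
  (K1 * (E + E) * m0 + C1 * D ^+ 2, C1 * (sm * d));
  (K2 * (E + E) * m0 + C2 * D ^+ 2, C2 * (sm * d))].
have [p|a a0 aP] := @exists_small_scale R conds.
  rewrite !inE => /or4P[/eqP->|/eqP->|/eqP->|/or3P[/eqP->|/eqP->|/eqP->]] /=.
  - by rewrite invr_gt0.
  - by rewrite mulr_gt0.
  - by rewrite !mulr_gt0// subr_gt0.
  - by rewrite divr_gt0// mulr_gt0.
  - by rewrite !mulr_gt0.
  - by rewrite !mulr_gt0.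
exists a => // x y z zeta lam sigma dx dy dz bi nb /andP[s1 s2] nd.
have /(DP _ _ _ _ _ _ _ _ _ bi)/(_ nd) [dxD dyD dzD] : 0 <= sigma <= 1.
  apply/andP; split; first by apply: le_trans s1; apply: ltW.
  by move: s2 sM; clear -P y0 hQ hrank hprm n_gt0; lra.
have xzb := bounded_iterate_ge hprm B0 bi.
have [c1 c2 c3 c4 [c5 c6]] : [/\ a * 1 <= 2^-1, a * (100 * D ^+ 2) <= 49 * d,
  a * (2 * D ^+ 2) <= (1 - gm) * (sm * d), a * (2 * D) <= gm * d / B &
  a * (K1 * (E + E) * m0 + C1 * D ^+ 2) <= C1 * (sm * d) /\
  a * (K2 * (E + E) * m0 + C2 * D ^+ 2) <= C2 * (sm * d)].
  by split; [..|split]; apply: (aP (_, _)); rewrite !inE eqxx ?orbT.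
case: (bi) => x0 z0 xz dt [xB yB zB zetaB lamB].
case: nd => nd1 nd2 nd3; have [muE entE] := mu_of_step a nd3.
case: nb => _ _ _ [bt [ct [ctn cts np ndl]]].
have qD : `|mu dx dz| <= D ^+ 2 by apply: mu_le_sqr.
move: (mu dx dz) qD muE => q qD muE.
have tB : `|mu x z| <= B ^+ 2 by apply: mu_le_sqr.
rewrite /admissible_step.
move: (mu x z) tB dt xz nd1 nd2 nd3 muE entE np ndl => t tB dt xz nd1 nd2 nd3 muE entE np ndl.
have t0 : 0 < t by apply: lt_le_trans dt.
have a1 : a < 1 by move: c1; clear -P y0 hQ hrank hprm n_gt0; lra.
have sgd : sm * d <= sigma * t by rewrite ler_pM// ltW.
have qle : a ^+ 2 * q <= a ^+ 2 * D ^+ 2.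
  by rewrite ler_wpM2l ?sqr_ge0// (le_trans (ler_norm _)).
have xa0 : pos_vec (x + a *: dx).
  move=> i; rewrite !mxlinE; have [xb _] := xzb i.
  have /andP[+ _] := entry_bound i dxD.
  move=> /(ler_wpM2l (ltW a0)); move: c4 xb (x0 i); clear -P y0 hQ hrank hprm n_gt0; lra.
have za0 : pos_vec (z + a *: dz).
  move=> i; rewrite !mxlinE; have [_ zb] := xzb i.
  have /andP[+ _] := entry_bound i dzD.
  move=> /(ler_wpM2l (ltW a0)); move: c4 zb (z0 i); clear -P y0 hQ hrank hprm n_gt0; lra.
have ta0 := mu_of_gt0 n_gt0 xa0 za0.
move: (mu (x + a *: dx) (z + a *: dz)) ta0 muE => ta ta0 taE.
split; first by rewrite a0 ltW.
  rewrite taE.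
  have s3 : sigma <= 2^-1 by apply: le_trans sM.
  have : a * (sigma * t) <= a * (2^-1 * t) by rewrite ler_pM2l// ler_wpM2r// ltW.
  have := ler_wpM2l (ltW a0) (le_trans c2 (ler_wpM2l (ler0n R 49) dt)).
  by move: qle; clear -P y0 hQ hrank hprm n_gt0; lra.
split=> //.
  move=> i; rewrite entE taE.
  have : (1 - a) * (gm * t) <= (1 - a) * (x i 0 * z i 0) by rewrite ler_wpM2l// subr_ge0 ltW.
  have h : - D ^+ 2 <= dx i 0 * dz i 0.
    rewrite lerNl (le_trans (ler_norm _))// normrN normrM expr2 ler_pM//.
      by rewrite (le_trans (le_entry_norm _ _)).
    by rewrite (le_trans (le_entry_norm _ _)).
  have := ler_wpM2l (sqr_ge0 a) h.
  have : gm * (a ^+ 2 * q) <= a ^+ 2 * D ^+ 2.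
    apply: (@le_trans _ _ (gm * (a ^+ 2 * D ^+ 2))); first by rewrite ler_pM2l.
    by rewrite ler_piMl ?mulr_ge0 ?sqr_ge0// ltW.
  have gm1' : 0 <= 1 - gm by rewrite subr_ge0 ltW.
  have := ler_wpM2l (ltW a0) (le_trans c3 (ler_wpM2l gm1' sgd)).
  by clear -P y0 hQ hrank hprm n_gt0; lra.
have m0n : m0 != 0 by rewrite gt_eqF.
have tan : ta != 0 by rewrite gt_eqF.
have lin : `|(sigma - 1) * t + a * q| <= B ^+ 2 + D ^+ 2.
  rewrite (le_trans (ler_normD _ _))// lerD// normrM.
    by rewrite (le_trans _ tB)// ler_piMl// ler_norml; apply/andP; split;
      move: s1 s2 sM sm0; clear -P y0 hQ hrank hprm n_gt0; lra.
  by rewrite (le_trans _ qD)// ler_piMl// ger0_norm ?ltW.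
have qm : `|q / m0| <= D ^+ 2 / m0.
  by rewrite normrM normfV (gtr0_norm m00) ler_wpM2r// invr_ge0 ltW.
pose ep := q *: (y - lam) - (q / m0) *: bbar P prm + ((sigma - 1) * t + a * q) *: dy.
pose ed := - (q *: (x - zeta)) - (q / m0) *: cbar P prm y0
  - ((sigma - 1) * t + a * q) *: dx.
have epE : `|ep| <= E.
  apply: (@le_trans _ _ E1); last by rewrite lerDl.
  by rewrite /ep /E1; norm_bound.
have edE : `|ed| <= E.
  apply: (@le_trans _ _ E2); last by rewrite lerDr.
  by rewrite /ed /E2; norm_bound.
have small N C : 0 <= C -> a * (N * (E + E) * m0 + C * D ^+ 2) <= C * (sm * d) ->
    a * (N * (E + E) * m0 + C * `|q|) <= C * (sigma * t).
  move=> C0 c; apply: (@le_trans _ _ (C * (sm * d))); last by rewrite ler_wpM2l.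
  by apply: le_trans c; rewrite ler_pM2l// lerD2l ler_wpM2l.
(* The perturbations are those produced by the two residual identities. *)
exists ((m0 / ta) *: (((1 - a) * (t / m0)) *: bt + a ^+ 2 *: ep)),
  ((m0 / ta) *: (((1 - a) * (t / m0)) *: ct + a ^+ 2 *: ed)); split.
- by apply: (sublinear_step n2D n2Z n2K K10 CN0 m00 a0 a1 t0 ta0 taE ctn epE edE);
    apply: small => //; apply: ltW.
- by apply: (sublinear_step snD snZ snK K20 C20 m00 a0 a1 t0 ta0 taE cts epE edE);
    apply: small => //; apply: ltW.
- exact: primal_residual_step.
- exact: dual_residual_step.
Qed.

End StepLength.

(** * Limit points of a run *)

Section Run.
Context {R : realType} {m n : nat} (P : qp R m n) (prm : ippmm_params R).
Context (y0 : 'cV[R]_m).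
Hypothesis hQ : sym_psd (qp_Q P).
Hypothesis hrank : \rank (qp_A P) = m.
Hypothesis hprm : valid_params prm.
Hypothesis n_gt0 : (0 < n)%N.

Local Notation rho := (ip_rho prm).
Local Notation m0 := (mu0 n prm).
Local Notation mu s := (mu_of (st_x s) (st_z s)).

(** [w] stands for the [z] with which the current estimates passed the test; the state does not
    store it. *)
Definition run_invariant (s : state R m n) : Prop :=
  [/\ neighbourhood P prm y0 (mu s) (st_zeta s) (st_lam s) (st_x s) (st_y s) (st_z s),
      mu s <= m0 &
      exists w, [/\ pos_vec (st_zeta s), pos_vec w, mu_of (st_zeta s) w <= m0 &
        update_test P prm y0 (st_zeta s) (st_lam s) w]].

Lemma seminorm00 : seminorm P 0 0 <= 0.
Proof.
rewrite -[leRHS](@norm2_0 R (n + n)) -(@col_mx0 R n n 1).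
by apply: (@seminorm_le _ _ _ _ _ _ _ 0); rewrite !mulmx0 ?oppr0 ?addr0.
Qed.

(** At the start [mu / mu0 = 1] and [bbar], [cbar] are the exact residuals, so zero perturbations
    serve both the neighbourhood and the test. *)
Lemma run_invariant0 : run_invariant (init_state n prm y0).
Proof.
have [rho0 CN0 /andP[gA0 gA1] /andP[gm0 gm1] _] := hprm.
have m00 : 0 < m0 by apply: mu0_gt0.
have m1 : m0 / m0 = 1 by rewrite divff// gt_eqF.
have st0 := start_gt0 (n := n) hprm.
have m0E : m0 = rho * rho.
  rewrite /mu0 /mu_of dotvE (eq_bigr (fun=> rho * rho)).
    by rewrite sumr_const card_ord -[_ *+ n]mulr_natr mulfK// gt_eqF// natn_gt0.
  by move=> i _; rewrite !mxE mulr1.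
split=> //=; first split=> //.
- by move=> i; rewrite -/(mu0 n prm) m0E !mxE mulr1 ler_piMl ?mulr_ge0 ?(ltW rho0) ?(ltW gm1).
- exists 0, 0; rewrite col_mx0 norm2_0 !subrr !scaler0 -/(mu0 n prm) m1; split.
  + exact: ltW.
  + by apply: le_trans seminorm00 _; rewrite mulr_ge0// ltW.
  + by rewrite scale1r !addr0 /bbar [RHS]addrC subrK.
  + by rewrite scale1r addr0 subr0 /cbar [RHS]addrC subrK.
exists (start n prm); split=> //.
rewrite /update_test -/(mu0 n prm) m1 !scale1r /bbar /cbar.
rewrite ![qp_b P + _]addrC ![qp_c P + _]addrC !subrK !subrr col_mx0 norm2_0 !mulr1.
split; first exact: ltW.
by apply: le_trans seminorm00 _; rewrite mulr_ge0// ltW.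
Qed.

(** Once the estimates are reset to the iterate, the proximal terms vanish, and the residuals of the
    test, rescaled by [mu0 / mu], are the required perturbations. *)
Lemma update_test_neighbourhood x y z zeta lam :
  neighbourhood P prm y0 (mu_of x z) zeta lam x y z -> update_test P prm y0 x y z ->
  neighbourhood P prm y0 (mu_of x z) x y x y z.
Proof.
move=> [x0 z0 xz _]; rewrite /update_test; set rp := _ - _; set rd := _ - _.
have t0 := mu_of_gt0 n_gt0 x0 z0.
have m00 : 0 < m0 by apply: mu0_gt0.
move: @rp @rd t0 xz; move: (mu_of x z) => t rp rd t0 xz [nrm semi].
split=> //.
have [_ n2Z _] := @norm2_sublinear R m n.
have [_ snZ _] := seminorm_sublinear hrank.
have tm0 : 0 < m0 / t by rewrite divr_gt0.
have cancel : t / m0 * (m0 / t) = 1 by field; rewrite !gt_eqF.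
exists ((m0 / t) *: rp), ((m0 / t) *: rd); split.
- apply: le_trans (n2Z _ _ _ tm0) _.
  by rewrite -[leRHS]mulr1 -cancel mulrA [leRHS]mulrC ler_pM2l.
- apply: le_trans (snZ _ _ _ tm0) _.
  by rewrite -[leRHS]mulr1 -cancel mulrA [leRHS]mulrC ler_pM2l.
- rewrite subrr scaler0 addr0 scalerDr scalerA cancel scale1r /rp.
  by rewrite addrA addrC subrK.
- rewrite subrr scaler0 subr0 scalerDr scalerA cancel scale1r /rd.
  by rewrite addrA addrC subrK.
Qed.

Lemma run_invariantS s s' : run_invariant s -> ippmm_step P prm y0 s s' ->
  run_invariant s' /\ mu s' <= mu s.
Proof.
case: s s' => [x y z zeta lam] [x' y' z' zeta' lam'].
move=> [nb mum test] [sg [a [dx [dy [dz [_ _ [[/andP[a0 a1] mua nb'] _]]]]]]] /=.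
rewrite /run_invariant /= in nb mum test *.
move=> [-> -> ->] [upd noupd].
have mule : mu_of (x + a *: dx) (z + a *: dz) <= mu_of x z.
  apply: le_trans mua _; rewrite ler_piMl//.
    by case: nb => ? ? _ _; apply/ltW/mu_of_gt0.
  by rewrite gerBl divr_ge0// ltW.
split=> //; have [t|t] := pselect (update_test P prm y0 (x + a *: dx) (y + a *: dy) (z + a *: dz)).
  have [-> ->] := upd t; split.
  - exact: update_test_neighbourhood nb' t.
  - exact: le_trans mum.
  - exists (z + a *: dz); case: nb' => ? ? _ _; split=> //; exact: le_trans mum.
have [-> ->] := noupd t; split=> //; exact: le_trans mum.
Qed.

Lemma run_invariants s k : ippmm_run P prm y0 s -> run_invariant (s k).
Proof.
move=> [s0 sS]; elim: k => [|k IHk]; first by rewrite s0; apply: run_invariant0.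
by have [] := run_invariantS IHk (sS k).
Qed.

Lemma run_mu_nonincreasing s k l : ippmm_run P prm y0 s -> (k <= l)%N ->
  mu (s l) <= mu (s k).
Proof.
move=> hs; have [_ sS] := hs; elim: l => [|l IHl]; first by rewrite leqn0 => /eqP->.
rewrite leq_eqVlt => /predU1P[->//|]; rewrite ltnS => /IHl; apply: le_trans.
by have [] := run_invariantS (run_invariants l hs) (sS l).
Qed.

(** The cluster property is tested on the tail from [N] and the ball of radius [e], which is a ball
    in each component. *)
Lemma limit_point_near (s : nat -> state R m n) x y z :
  iterates_limit_point s x y z -> forall e N, 0 < e ->
  exists2 k, (N <= k)%N & [/\ `|x - st_x (s k)| <= e, `|y - st_y (s k)| <= e &
    `|z - st_z (s k)| <= e].
Proof.
move=> hlim e N e0.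
pose f k := (st_x (s k), st_y (s k), st_z (s k)).
have [|p [[k [Nk ->]]]] := hlim [set p | exists k, (N <= k)%N /\ p = f k]%classic
    (ball (x, y, z) e) _ (nbhsx_ballx _ _ e0).
  by exists N => // k Nk; exists k.
rewrite /ball /= => -[[]].
rewrite /f /= -!ball_normE /ball_ /= => hx hy hz.
by exists k => //; split; apply: ltW.
Qed.

End Run.

(** * Vanishing of [mu] and optimality of the limit point *)

Section LimitPoint.
Context {R : realType} {m n : nat} (P : qp R m n) (prm : ippmm_params R).
Context (y0 : 'cV[R]_m).
Hypothesis hQ : sym_psd (qp_Q P).
Hypothesis hrank : \rank (qp_A P) = m.
Hypothesis hprm : valid_params prm.
Hypothesis n_gt0 : (0 < n)%N.

Local Notation m0 := (mu0 n prm).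
Local Notation CN := (ip_CN prm).
Local Notation mu s := (mu_of (st_x s) (st_z s)).

Variable s : nat -> state R m n.
Hypothesis hs : ippmm_run P prm y0 s.
Variables (x : 'cV[R]_n) (y : 'cV[R]_m) (z : 'cV[R]_n).
Hypothesis hlim : iterates_limit_point s x y z.
Hypothesis hopt : exists (xs : 'cV[R]_n) ys zs, primal_dual_optimal P xs ys zs.

Lemma estimates_bounded : exists2 K, 0 <= K &
  forall k, `|st_zeta (s k)| <= K /\ `|st_lam (s k)| <= K.
Proof.
have [xs [ys [zs opt]]] := hopt.
have [K K0 KP] := update_test_bounded y0 hQ hrank hprm n_gt0 opt.
exists K => // k.
by have [_ _ [w [zeta0 w0 le test]]] := run_invariants hrank hprm n_gt0 k hs; apply: (KP _ _ w).
Qed.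

Lemma run_mu_vanishes e : 0 < e -> exists k, mu (s k) < e.
Proof.
move=> e0; apply: contrapT => /forallNP H.
have mue k : e <= mu (s k) by rewrite leNgt; apply/negP/H.
have [K K0 KP] := estimates_bounded.
(* The summand 1 is the distance allowed between the limit point and the chosen iterate. *)
pose B := 1 + `|x| + `|y| + `|z| + K.
have := normr_ge0 x; have := normr_ge0 y; have := normr_ge0 z => zz yy xx.
have B0 : 0 < B by rewrite /B; lra.
have [a a0 aP] := admissible_uniform y0 hQ hrank hprm n_gt0 B0 e0.
(* Some iterate near the limit point has [mu] within [a / 100 * e] of the infimum; a step of length
   at least [a] from it would go below the infimum. *)
pose M := range (fun k => mu (s k)).
have hM : has_inf M.
  split; first by exists (mu (s 0%N)), 0%N.
  by exists e => _ [k _ <-].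
have c0 : 0 < a / 100%:R * e by rewrite mulr_gt0// divr_gt0.
have [_ [N _ <-] muN] := inf_adherent c0 hM.
have [k Nk [kx ky kz]] := limit_point_near hlim N ltr01.
have muk := run_mu_nonincreasing hrank hprm n_gt0 hs Nk.
have infS : inf M <= mu (s k.+1) by apply: ge_inf; [exact: hM.2|exists k.+1].
have := hs.2 k; have := run_invariants hrank hprm n_gt0 k hs.
have := KP k; have := norm_nearW kx; have := norm_nearW ky; have := norm_nearW kz.
have := mue k.
case: (s k) muk => u v w zeta lam /= muk ek zB yB xB [zetaB lamB] [nb _ _].
rewrite /ippmm_step.
move=> [sg [b [dx [dy [dz [sgs nd [adm maxb] [/= ex ey ez] _]]]]]].
(* Maximality of the accepted step [b] gives [a <= b]. *)
have /maxb ab : admissible_step P prm y0 (State u v w zeta lam) dx dy dz a.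
  apply: (aP _ _ _ _ _ sg) => //; case: nb => u0 w0 uw _; split=> //.
  by split; rewrite /B; lra.
case: adm => _ mub _; move: infS; rewrite ex ez => infS.
have : a / 100%:R * e <= b / 100%:R * mu_of u w.
  by rewrite ler_pM// ?(ltW e0) ?divr_ge0 ?(ltW a0)// ler_pM2r ?invr_gt0.
lra.
Qed.

(** Monotonicity of [mu] makes it small along a whole tail, which still meets every neighbourhood of
    the limit point. *)
Lemma near_iterate e : 0 < e -> exists k, [/\ `|x - st_x (s k)| <= e,
  `|y - st_y (s k)| <= e, `|z - st_z (s k)| <= e & mu (s k) <= e].
Proof.
move=> e0; have [N muN] := run_mu_vanishes e0.
have [k Nk [kx ky kz]] := limit_point_near hlim N e0.
exists k; split=> //; apply: le_trans (ltW muN).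
exact: (run_mu_nonincreasing hrank hprm n_gt0 hs Nk).
Qed.

Lemma limit_point_solution : [/\ qp_c P + qp_Q P *m x - (qp_A P)^T *m y - z = 0,
      qp_A P *m x - qp_b P = 0,
      diagv x *m diagv z *m ones R n = 0,
      nonneg_vec x & nonneg_vec z].
Proof.
have [K K0 KP] := estimates_bounded.
have m00 : 0 < m0 by apply: mu0_gt0.
split.
- pose C := n%:R * `|qp_Q P| + m%:R * `|(qp_A P)^T| + 1
    + m0^-1 * (`|cbar P prm y0| + CN) + (`|x| + 1 + K).
  apply/norm_le0_eq0/(@le0_of_linear_bound _ _ C) => e e0 e1.
  have [k [kx ky kz mue]] := near_iterate e0.
  have [zetaK lamK] := KP k; have xk := norm_nearW kx.
  have [[x0 z0 _ [bt [ct [nrm _ _ E]]]] _ _] := run_invariants hrank hprm n_gt0 k hs.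
  move: (mu (s k)) (mu_of_gt0 n_gt0 x0 z0) mue E => t t0 te E.
  (* The residual at the limit is its difference to the iterate plus, by the neighbourhood equation,
     terms with a factor [mu] whose cofactors stay bounded because the estimates do. *)
  have -> : qp_c P + qp_Q P *m x - (qp_A P)^T *m y - z =
      qp_Q P *m (x - st_x (s k)) - (qp_A P)^T *m (y - st_y (s k)) - (z - st_z (s k))
      - (t *: (m0^-1 *: (cbar P prm y0 + ct)) + t *: (st_x (s k) - st_zeta (s k))).
    rewrite !mulmxBr; apply/matrixP => i j; move/matrixP/(_ i j): E.
    by rewrite !mxlinE => E; lra.
  have -> : C * e = n%:R * `|qp_Q P| * e + m%:R * `|(qp_A P)^T| * e + e
     + (e * (m0^-1 * (`|cbar P prm y0| + CN)) + e * (`|x| + 1 + K)).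
    by rewrite /C; ring.
  have tE : `|t| <= e by rewrite gtr0_norm.
  have ctN := le_trans (norm_dsub_le bt ct) nrm.
  have m0V : `|m0^-1| <= m0^-1 by rewrite gtr0_norm// invr_gt0.
  have xk1 : `|st_x (s k)| <= `|x| + 1 by rewrite (le_trans xk)// lerD2l.
  by norm_bound.
- pose C := n%:R * `|qp_A P| + m0^-1 * (`|bbar P prm| + CN) + (`|y| + 1 + K).
  apply/norm_le0_eq0/(@le0_of_linear_bound _ _ C) => e e0 e1.
  have [k [kx ky kz mue]] := near_iterate e0.
  have [zetaK lamK] := KP k; have yk := norm_nearW ky.
  have [[x0 z0 _ [bt [ct [nrm _ E _]]]] _ _] := run_invariants hrank hprm n_gt0 k hs.
  move: (mu (s k)) (mu_of_gt0 n_gt0 x0 z0) mue E => t t0 te E.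
  have -> : qp_A P *m x - qp_b P = qp_A P *m (x - st_x (s k)) +
      t *: (m0^-1 *: (bbar P prm + bt)) - t *: (st_y (s k) - st_lam (s k)).
    rewrite !mulmxBr; apply/matrixP => i j; move/matrixP/(_ i j): E.
    by rewrite !mxlinE => E; lra.
  have -> : C * e = n%:R * `|qp_A P| * e
     + e * (m0^-1 * (`|bbar P prm| + CN)) + e * (`|y| + 1 + K).
    by rewrite /C; ring.
  have tE : `|t| <= e by rewrite gtr0_norm.
  have btN := le_trans (norm_usub_le bt ct) nrm.
  have m0V : `|m0^-1| <= m0^-1 by rewrite gtr0_norm// invr_gt0.
  have yk1 : `|st_y (s k)| <= `|y| + 1 by rewrite (le_trans yk)// lerD2l.
  by norm_bound.
- rewrite -mulmxA; apply/matrixP => i j; rewrite ord1 !diagv_mulmx [ones _ _ _ _]mxE mulr1.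
  rewrite [RHS]mxE; apply/eqP; rewrite -normr_le0.
  pose C := `|z| + (`|x| + 1) + n%:R.
  apply: (@le0_of_linear_bound _ _ C) => e e0 e1.
  have [k [kx ky kz mue]] := near_iterate e0; have xk := norm_nearW kx.
  have [[x0 z0 _ _] _ _] := run_invariants hrank hprm n_gt0 k hs.
  have xz : st_x (s k) i 0 * st_z (s k) i 0 <= n%:R * e.
    apply: le_trans (ler_wpM2l (ler0n R n) mue); rewrite -dotv_mu_of// dotvE.
    rewrite (bigD1 i)//= lerDl sumr_ge0// => l _.
    by rewrite mulr_ge0// ltW.
  (* The last product is at most [n * mu], all products of the iterate being positive. *)
  have -> : x i 0 * z i 0 = (x - st_x (s k)) i 0 * z i 0 +
      st_x (s k) i 0 * (z - st_z (s k)) i 0 + st_x (s k) i 0 * st_z (s k) i 0.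
    by rewrite !mxlinE; ring.
  have -> : C * e = e * `|z| + (`|x| + 1) * e + n%:R * e by rewrite /C; ring.
  rewrite (le_trans (ler_normD _ _))// lerD//; last by rewrite ger0_norm// mulr_ge0// ltW.
  rewrite (le_trans (ler_normD _ _))// lerD// normrM ler_pM ?le_entry_norm//.
  + by rewrite (le_trans (le_entry_norm _ _)).
  + by rewrite (le_trans (le_entry_norm _ _))// (le_trans xk)// lerD2l.
  + by rewrite (le_trans (le_entry_norm _ _)).
- move=> i; rewrite -oppr_le0; apply: (@le0_of_linear_bound _ _ 1) => e e0 e1.
  have [k [kx _ _ _]] := near_iterate e0.
  have [[x0 z0 _ _] _ _] := run_invariants hrank hprm n_gt0 k hs.
  by have /andP[] := entry_bound i kx; have := x0 i; rewrite !mxlinE; lra.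
- move=> i; rewrite -oppr_le0; apply: (@le0_of_linear_bound _ _ 1) => e e0 e1.
  have [k [_ _ kz _]] := near_iterate e0.
  have [[x0 z0 _ _] _ _] := run_invariants hrank hprm n_gt0 k hs.
  by have /andP[] := entry_bound i kz; have := z0 i; rewrite !mxlinE; lra.
Qed.

End LimitPoint.

Theorem theorem3p9 (R : realType)
    (prm : ippmm_params R) (Cstar CA1 CA2 CQ Cr Cy : R)
    (hprm : valid_params prm) (hCstar : 0 <= Cstar)
    (hCA1 : 0 < CA1) (hCA2 : 0 < CA2) (hCQ : 0 < CQ) (hCr : 0 < Cr)
    (m n : nat) (hmn : (m <= n)%N) (P : qp R m n) (hQ : sym_psd (qp_Q P))
    (hopt : exists (xs : 'cV[R]_n) (ys : 'cV[R]_m) (zs : 'cV[R]_n),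
        primal_dual_optimal P xs ys zs /\
        [/\ `|xs| <= Cstar, `|ys| <= Cstar & `|zs| <= Cstar])
    (hrank : \rank (qp_A P) = m)
    (hAmin : CA1 <= eta_min (qp_A P)) (hAmax : eta_max (qp_A P) <= CA2)
    (hQmax : nu_max (qp_Q P) <= CQ)
    (hcb : `|col_mx (qp_c P) (qp_b P)| <= Cr)
    (y0 : 'cV[R]_m) (hy0 : `|y0| <= Cy)
    (s : nat -> state R m n) (hs : ippmm_run P prm y0 s)
    (x : 'cV[R]_n) (y : 'cV[R]_m) (z : 'cV[R]_n)
    (hlim : iterates_limit_point s x y z) :
  [/\ qp_c P + qp_Q P *m x - (qp_A P)^T *m y - z = 0,
      qp_A P *m x - qp_b P = 0,
      diagv x *m diagv z *m ones R n = 0,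
      nonneg_vec x & nonneg_vec z].
Proof.
have hopt' : exists (xs : 'cV[R]_n) ys zs, primal_dual_optimal P xs ys zs.
  by have [xs [ys [zs [opt _]]]] := hopt; exists xs, ys, zs.
(* [mu_of] divides by [n], so dimension 0 is separate; there [m = 0] as well and all the vectors are
   empty. *)
case: (posnP n) => [n0|n_gt0]; last first.
  exact: (limit_point_solution hQ hrank hprm n_gt0 hs hlim hopt').
have no_n (i : 'I_n) : False by case: i => i; rewrite n0.
have no_m (i : 'I_m) : False by case: i => i; rewrite ltnNge (leq_trans hmn) ?n0.
split; try by move=> i; case: (no_n i).
- by apply/matrixP => i; case: (no_n i).
- by apply/matrixP => i; case: (no_m i).
- by apply/matrixP => i; case: (no_n i).
Qed.
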